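(* There are infinitely many (pairwise non-isomorphic) $4$-regular graphs of connectivity exactly $3$, each containing exactly $2^{12}\cdot 5 = 20\,480$ hamiltonian cycles. Furthermore, there are infinitely many (pairwise non-isomorphic) polyhedral $4$-regular graphs, each containing exactly $2\cdot 5^5\cdot 13 = 81\,250$ hamiltonian cycles.
   Context: Graphs are finite and simple. A graph is polyhedral if it is planar and $3$-connected. A hamiltonian cycle is a cycle through all vertices of the graph. *)

(* Defs.v *)
From HB Require Import structures.
From mathcomp Require Import all_boot all_order all_algebra.
From mathcomp Require Import all_classical all_reals all_analysis.

Set Implicit Arguments.
Unset Strict Implicit.
Unset Printing Implicit Defensive.

Import Order.TTheory GRing.Theory Num.Theory.
Import numFieldNormedType.Exports.

Record sgraph := SGraph {
  vertex :> finType;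
  edge : rel vertex;
  edge_sym : symmetric edge;
  edge_irr : irreflexive edge }.

Definition graph_iso (G H : sgraph) : Prop :=
  exists f : G -> H, bijective f /\ {mono f : x y / edge x y}.

Definition regular (k : nat) (G : sgraph) : Prop :=
  forall x : G, #|[set y | edge x y]%SET| = k.

Definition edges (G : sgraph) : {set {set G}} :=
  [set F : {set G} |
    [exists x, exists y, edge x y && (F == [set x; y])]]%SET.

Definition connected_without (G : sgraph) (S : {set G}) : bool :=
  [forall x, forall y, (x \notin S) && (y \notin S) ==>
    connect [rel u v | [&& edge u v, u \notin S & v \notin S]] x y].

Definition k_connected (k : nat) (G : sgraph) : bool :=
  (k < #|G|) && [forall S : {set G}, (#|S| < k) ==> connected_without S].

(* K_n has connectivity n - 1. *)
Definition connectivity (G : sgraph) : nat :=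
  \max_(k < #|G| | k_connected k G) k.

Definition hamiltonian_seq (G : sgraph) (c : seq G) : bool :=
  [&& 2 < size c, ucycleb (@edge G) c & [forall x : G, x \in c]].

Definition cycle_edges (G : sgraph) (c : seq G) : {set {set G}} :=
  [set [set x; next c x] | x in c]%SET.

(* A hamiltonian cycle is a subgraph, represented by its edge set, so that
   neither the starting vertex nor the direction of traversal matters.
   A repetition-free enumeration of all vertices has length #|G|, so ranging
   over tuples of that length loses nothing. *)
Definition hamiltonian_cycles (G : sgraph) : {set {set {set G}}} :=
  [set cycle_edges c | c : #|G|.-tuple G & hamiltonian_seq c]%SET.

Local Open Scope ring_scope.
Local Open Scope classical_set_scope.

(* The edge F is drawn as the arc [arc F] parametrised by [0, 1], in either
   direction. *)
Record plane_drawing (R : realType) (G : sgraph)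
    (pt : G -> R * R) (arc : {set G} -> R -> R * R) : Prop := {
  drawing_pt_inj : injective pt;
  drawing_arc_continuous : forall F : {set G}, F \in edges G ->
    {within `[0, 1], continuous (arc F)};
  drawing_arc_inj : forall F : {set G}, F \in edges G ->
    forall s t : R, 0 <= s <= 1 -> 0 <= t <= 1 -> arc F s = arc F t -> s = t;
  drawing_arc_ends : forall x y : G, edge x y ->
    let F := [set x; y]%SET in
    (arc F 0 = pt x /\ arc F 1 = pt y) \/ (arc F 0 = pt y /\ arc F 1 = pt x);
  drawing_arc_avoids_pt : forall F : {set G}, F \in edges G ->
    forall t : R, 0 < t < 1 -> forall z, arc F t <> pt z;
  drawing_arcs_disjoint : forall F F' : {set G},
    F \in edges G -> F' \in edges G -> F != F' ->
    forall s t : R, 0 < s < 1 -> 0 < t < 1 -> arc F s <> arc F' t }.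

Definition planar (R : realType) (G : sgraph) : Prop :=
  exists (pt : G -> R * R) (arc : {set G} -> R -> R * R),
    plane_drawing pt arc.

Definition polyhedral (R : realType) (G : sgraph) : Prop :=
  planar R G /\ k_connected 3 G.

Definition infinitely_many (P : sgraph -> Prop) : Prop :=
  exists G : nat -> sgraph,
    (forall i j, i <> j -> ~ graph_iso (G i) (G j)) /\ (forall i, P (G i)).

(* Main.v *)
Require Import Defs.
From Stdlib Require Import NArith.
From mathcomp Require Import all_boot all_order all_algebra.
From mathcomp Require Import all_classical all_reals all_analysis.
From mathcomp Require Import zify ring lra.

(** Each family consists of a left cap and a right cap joined by a strip (the
    square of a path, of arbitrary length [n]) and by one further edge [e].  The
    left cap is chosen such that no hamiltonian cycle can use [e]: inside the
    left cap every hamiltonian cycle is a spanning path between the two vertices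
    to which the strip is attached.  Such a path extends through the strip in
    exactly one way, a zigzag, so the number of hamiltonian cycles is the number
    of these spanning paths times the number of completions in the right cap,
    independently of [n]: 5120 * 4 when the right cap is complete on 4 vertices,
    and 16250 * 5 when it is a wheel on 5 vertices.  Both factors are computed by
    a frontier sweep.

    The end of the strip together with [e] gives a 3-cut.  No 2-set [S] separates
    the graph: contracting a strip edge that avoids [S] gives a shorter member of
    the family, and a short member is checked exhaustively.  The wheel family is
    drawn with straight edges: the caps are drawn on a grid with [e] horizontal on
    top, and lengthening the strip translates the right cap. *)

(** The graphs grow with [n] while evaluation needs closed terms, so the count is moved from edge
    sets over ['I_N] to the list [sols] of a program, which is invariant under injective renaming.
    The left cap runs first, from the empty state, and the right cap last, so each is evaluated once
    with fixed labels and only the strip in between needs induction. The right cap has the smallest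
    labels, so lengthening the strip renames none of its vertices. That no hamiltonian cycle uses
    [e] is not argued by hand: it is read off the run over the left cap, which leaves a single
    state, and in it [e] already has two selected edges. Listing the selections gives the bijection
    with cycles; their large number in the left cap is only evaluated through a run that merges
    equal states. *)

Set Implicit Arguments.
Unset Strict Implicit.
Unset Printing Implicit Defensive.

(** * Sweep programs for spanning path systems *)

(* A graph is read as a program that inserts vertices, offers edges, and
   retires vertices all of whose edges have been offered. *)
Inductive instr (T : Type) := Add of T | Edge of T & T | Drop of T.
Arguments Add {T}.
Arguments Edge {T}.
Arguments Drop {T}.

Definition instr_map (T U : Type) (f : T -> U) (i : instr T) : instr U :=
  match i with
  | Add v => Add (f v)
  | Edge u v => Edge (f u) (f v)
  | Drop v => Drop (f v)
  end.

Section Stream.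
Variable T : eqType.
Implicit Types (p : seq (instr T)) (st : seq (T * option T)).

(* A state records a system of disjoint paths: a live vertex [v] is paired with
   [Some w] if it is an end of a path whose other end is [w] ([w = v] for a
   trivial path), and with [None] if it is interior to a path. *)
Fixpoint mate st (v : T) : option T :=
  if st is (u, m) :: st' then if u == v then m else mate st' v else None.

(** The new ends [a] and [b] are tested before [u] and [v]: for a trivial path [a = u], and [u]
    stays an end. *)
Definition link (u v a b : T) st :=
  [seq (x.1, if x.1 == a then Some b else if x.1 == b then Some a
             else if (x.1 == u) || (x.1 == v) then None else x.2) | x <- st].

(** Retired vertices are interior to paths. Hence, when this holds and no vertex remains to be
    inserted, closing the path between [u] and [v] gives one cycle through all vertices. *)
Definition closable (u v : T) st :=
  all (fun x => [|| x.1 == u, x.1 == v | x.2 == None]) st.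

Definition is_add (i : instr T) := if i is Add _ then true else false.

Definition drop_vertex (v : T) st := [seq x <- st | x.1 != v].

(* All edge selections that complete the paths of [st] to a single cycle through
   every vertex.  Selecting an edge between the two ends of one path closes the
   cycle, hence ends the selection. *)
Fixpoint sols p st : seq (seq (T * T)) :=
  match p with
  | [::] => [::]
  | Add v :: p' => sols p' (rcons st (v, Some v))
  | Drop v :: p' => if mate st v is None then sols p' (drop_vertex v st) else [::]
  | Edge u v :: p' =>
    sols p' st ++
    [seq (u, v) :: s | s <-
       match mate st u, mate st v with
       | Some a, Some b =>
         if a == v then nseq (closable u v st && ~~ has is_add p') [::]
         else sols p' (link u v a b st)
       | _, _ => [::]
       end]
  end.

Fixpoint stream_edges p : seq (T * T) :=
  match p with
  | [::] => [::]
  | Edge u v :: p' => (u, v) :: stream_edges p'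
  | _ :: p' => stream_edges p'
  end.

Fixpoint stream_adds p : seq T :=
  match p with
  | [::] => [::]
  | Add v :: p' => v :: stream_adds p'
  | _ :: p' => stream_adds p'
  end.

Definition touches (v : T) (e : T * T) := (e.1 == v) || (e.2 == v).

(** A retired vertex stays in [live], which thus only grows; instead, [Drop v] demands that no later
    edge touches [v]. *)
Fixpoint wf p (live : seq T) : bool :=
  match p with
  | [::] => true
  | Add v :: p' => wf p' (rcons live v)
  | Edge u v :: p' => [&& u \in live, v \in live, u != v & wf p' live]
  | Drop v :: p' =>
    ~~ has (touches v) (stream_edges p') && wf p' live
  end.

Fixpoint stream_drops p : seq T :=
  match p with
  | [::] => [::]
  | Drop v :: p' => v :: stream_drops p'
  | _ :: p' => stream_drops p'
  end.

Lemma stream_edges_cat p q :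
  stream_edges (p ++ q) = stream_edges p ++ stream_edges q.
Proof. by elim: p => [|[v|u v|v] p IH] //=; rewrite IH. Qed.

Lemma stream_adds_cat p q : stream_adds (p ++ q) = stream_adds p ++ stream_adds q.
Proof. by elim: p => [|[v|u v|v] p IH] //=; rewrite IH. Qed.

Lemma wf_cat p q live live' : wf p live ->
  all (fun v => ~~ has (touches v) (stream_edges q)) (stream_drops p) ->
  {subset live' <= live ++ stream_adds p} -> wf q live' -> wf (p ++ q) live.
Proof.
elim: p live => [|[v|u v|v] p IH] live /=.
- move=> _ _; rewrite cats0; elim: q live live' => [|[v|u v|v] q IHq] live live' sub //=.
  + apply: IHq => x; rewrite !mem_rcons !inE => /predU1P[->|/sub->];
    by rewrite ?eqxx ?orbT.
  + by move=> /and4P[/sub-> /sub-> -> /(IHq _ _ sub)].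
  + by move=> /andP[-> /(IHq _ _ sub)].
- by move=> wp d sub; apply: IH => // x /sub; rewrite cat_rcons.
- by move=> /and4P[-> -> -> wp] d sub wq; apply: IH.
- move=> /andP[np wp] /andP[nq d] sub wq; rewrite stream_edges_cat has_cat negb_or.
  by rewrite np nq IH.
Qed.

Lemma sols_subseq p st s : s \in sols p st -> subseq s (stream_edges p).
Proof.
elim: p st s => [|[v|u v|v] p IH] st s //=; first exact: IH.
- rewrite mem_cat => /orP[/IH sub|/mapP[s' s'P ->]].
    exact: (subseq_trans sub (subseq_cons _ _)).
  rewrite /= eqxx; move: s'P.
  case: (mate st u) => [a|] //; case: (mate st v) => [b|] //.
  case: ifP => _; last exact: IH.
  by case: (_ && _); rewrite // inE => /eqP ->; exact: sub0seq.
- by case: (mate st v) => // /IH.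
Qed.

(** The two branches at an offer are disjoint because each edge is offered once: a selection that
    skips it cannot contain it later. *)
Lemma sols_uniq p st : uniq (stream_edges p) -> uniq (sols p st).
Proof.
elim: p st => [|[v|u v|v] p IH] st //=; first exact: IH.
- move=> /andP[uvN up]; rewrite cat_uniq IH //=; apply/andP; split.
    apply/hasPn => x /mapP[s _ ->]; apply/negP => /sols_subseq sub.
    by move/negP: uvN; apply; apply: (mem_subseq sub); rewrite mem_head.
  rewrite map_inj_uniq; last by move=> s s' [].
  case: (mate st u) => [a|] //; case: (mate st v) => [b|] //.
  by case: ifP => _; [case: (_ && _) | exact: IH].
- by move=> up; case: (mate st v) => //; exact: IH.
Qed.

Lemma mate_notin st v : v \notin unzip1 st -> mate st v = None.
Proof.
elim: st => [|[u m] st IH] //=; rewrite inE negb_or => /andP[vu vst].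
by rewrite eq_sym (negPf vu) IH.
Qed.

Lemma mate_rcons st u v m : u \notin unzip1 st ->
  mate (rcons st (u, m)) v = if u == v then m else mate st v.
Proof.
elim: st => [|[w n] st IH] //=; rewrite inE negb_or => /andP[uw ust].
by rewrite IH //; case: (w =P v) => // <-; rewrite (negPf uw).
Qed.

Lemma mate_drop st u v :
  mate (drop_vertex u st) v = if u == v then None else mate st v.
Proof.
elim: st => [|[w n] st IH] /=; first by case: ifP.
case: (w =P u) => [->|/eqP wu] /=; rewrite IH.
  by case: ifP.
by case: (w =P v) => [<-|_]; rewrite // eq_sym (negPf wu).
Qed.

Lemma mate_link st u v a b w :
  mate (link u v a b st) w = if w \in unzip1 st then
    (if w == a then Some b else if w == b then Some a
     else if (w == u) || (w == v) then None else mate st w) else None.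
Proof.
elim: st => [|[x n] st IH] //=; rewrite inE [w == x]eq_sym.
by case: (x =P w) => [->|_] //=.
Qed.

Lemma unzip1_link st u v a b : unzip1 (link u v a b st) = unzip1 st.
Proof. by rewrite /unzip1 /link -map_comp. Qed.

Lemma unzip1_drop st v : unzip1 (drop_vertex v st) = [seq x <- unzip1 st | x != v].
Proof. by rewrite /unzip1 filter_map. Qed.

End Stream.

(** * Invariance of the sweep under injective renaming *)

Section Relabel.
Variables (T U : eqType) (f : T -> U).
Hypothesis f_inj : injective f.

Definition st_map (st : seq (T * option T)) := [seq (f x.1, omap f x.2) | x <- st].

Lemma mate_map st v : mate (st_map st) (f v) = omap f (mate st v).
Proof. by elim: st => [|[u m] st IH] //=; rewrite inj_eq //; case: ifP. Qed.

Lemma link_map u v a b st :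
  link (f u) (f v) (f a) (f b) (st_map st) = st_map (link u v a b st).
Proof.
rewrite /link /st_map -!map_comp; apply: eq_map => -[x m] /=.
by rewrite !inj_eq //; do 3?case: ifP.
Qed.

Lemma sols_map p st :
  sols (map (instr_map f) p) (st_map st) =
  [seq [seq (f e.1, f e.2) | e <- s] | s <- sols p st].
Proof.
elim: p st => [|[v|u v|v] p IH] st //=.
- by rewrite -IH /st_map map_rcons.
- rewrite map_cat IH; congr (_ ++ _); rewrite !mate_map.
  rewrite -[RHS]map_comp.
  case: (mate st u) => [a|] //=; case: (mate st v) => [b|] //=.
  rewrite inj_eq //; case: ifP => _.
    have -> : closable (f u) (f v) (st_map st) = closable u v st.
      rewrite /closable /st_map all_map; apply: eq_all => -[x m] /=.
      by rewrite !inj_eq //; case: m.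
    have -> : has (@is_add U) (map (instr_map f) p) = has (@is_add T) p.
      by rewrite has_map; apply: eq_has => -[].
    by case: (_ && _).
  by rewrite link_map IH -!map_comp.
- rewrite mate_map; case: (mate st v) => [a|] //=.
  rewrite -IH /st_map /drop_vertex filter_map; congr (sols _ (map _ _)).
  by apply: eq_filter => x /=; rewrite inj_eq.
Qed.

Lemma stream_edges_map p :
  stream_edges (map (instr_map f) p) = [seq (f e.1, f e.2) | e <- stream_edges p].
Proof. by elim: p => [|[v|u v|v] p IH] //=; rewrite IH. Qed.

Lemma stream_adds_map p : stream_adds (map (instr_map f) p) = map f (stream_adds p).
Proof. by elim: p => [|[v|u v|v] p IH] //=; rewrite IH. Qed.

Lemma stream_drops_map p : stream_drops (map (instr_map f) p) = map f (stream_drops p).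
Proof. by elim: p => [|[v|u v|v] p IH] //=; rewrite IH. Qed.

Lemma wf_map p live : wf (map (instr_map f) p) (map f live) = wf p live.
Proof.
elim: p live => [|[v|u v|v] p IH] live //=; first by rewrite -IH map_rcons.
- by rewrite !mem_map // inj_eq // IH.
- rewrite IH stream_edges_map has_map; congr (~~ _ && _).
  by apply: eq_has => e; rewrite /touches /= !inj_eq.
Qed.

(** Three renamings are needed: from ordinals to [nat], from [nat] to [N] for fast evaluation, and
    [shift], which moves the right cap to the end of a longer strip. *)
Lemma size_sols_map p st :
  size (sols (map (instr_map f) p) (st_map st)) = size (sols p st).
Proof. by rewrite sols_map size_map. Qed.

End Relabel.

(** * Path systems in a finite type *)

Section PathSystems.
Variable T : finType.
Implicit Types (p : seq T) (ps : seq (seq T)) (C : {set {set T}}).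
Implicit Types (st : seq (T * option T)).
Local Open Scope set_scope.

Definition path_edges p : seq {set T} :=
  if p is x :: s then pairmap (fun a b => [set a; b]) x s else [::].

Lemma path_edges_cat s x y t :
  path_edges (rcons s x ++ y :: t) =
  path_edges (rcons s x) ++ [set x; y] :: path_edges (y :: t).
Proof. by case: s => //= z s; rewrite pairmap_cat last_rcons. Qed.

Lemma path_edges_rev p : path_edges (rev p) = rev (path_edges p).
Proof.
elim: p => // x [|y t] IH //.
rewrite rev_cons -cats1 [rev (y :: t)]rev_cons path_edges_cat -rev_cons IH /=.
by rewrite rev_cons cats1 finset.setUC.
Qed.

Lemma path_edges_subset F p x : F \in path_edges p -> x \in F -> x \in p.
Proof.
case: p => //= y s; elim: s y => //= z s IH y; rewrite inE.
case/predU1P => [-> |/IH h /h]; last by rewrite !inE => ->; rewrite orbT.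
by rewrite !inE => /orP[] ->; rewrite ?orbT.
Qed.

Definition ends p v w := exists s, (p = v :: s \/ rev p = v :: s) /\ last v s = w.

Lemma rev_cons_last (x : T) s : rev (x :: s) = last x s :: rev (belast x s).
Proof. by rewrite lastI rev_rcons. Qed.

Lemma last_rev_belast (x : T) s : last (last x s) (rev (belast x s)) = x.
Proof.
have := rev_cons_last x s; rewrite rev_cons => /(congr1 (last x)).
by rewrite last_rcons /= => <-.
Qed.

Lemma ends_cons x s v w : ends (x :: s) v w <->
  (v = x /\ w = last x s) \/ (v = last x s /\ w = x).
Proof.
split=> [[t [[pE|rE] <-]]|[[-> ->]|[-> ->]]].
- by case: pE => -> ->; left.
- by move: rE; rewrite rev_cons_last => -[<- <-]; right; rewrite last_rev_belast.
- by exists s; split; [left|].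
- exists (rev (belast x s)); split; [right; exact: rev_cons_last|].
  exact: last_rev_belast.
Qed.

Lemma ends_sym p v w : ends p v w -> ends p w v.
Proof.
case: p => [[s [[//|//]]]|x s /ends_cons h]; apply/ends_cons; tauto.
Qed.

Lemma ends_mem p v w : ends p v w -> v \in p.
Proof.
by move=> [s [[->|rp] _]]; rewrite ?mem_head // -mem_rev rp mem_head.
Qed.

Definition degree C v := #|[set F in C | v \in F]|.

Lemma degreeU1 C F v : F \notin C -> degree (F |: C) v = degree C v + (v \in F).
Proof.
move=> FC; rewrite /degree; case: (boolP (v \in F)) => vF.
  have -> : [set F0 in F |: C | v \in F0] = F |: [set F0 in C | v \in F0].
    by apply/setP => E; rewrite !inE; case: eqP => // ->.
  by rewrite cardsU1 inE (negPf FC) /= addnC.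
rewrite addn0; apply: eq_card => E; rewrite !inE.
by case: eqP => // ->; rewrite (negPf vF) (negPf FC).
Qed.

(** The invariant of the sweep. [C] holds the selected edges and [A] all vertices inserted so far,
    including the retired ones, which need not be keys of [st]. The equivalence in [ps_mate] makes
    every path end live; by [ps_deg] an end has degree 1, or 0 if its path is trivial, and every
    other vertex of [A] has degree 2. *)
Record path_system ps C (A : seq T) st : Prop := PathSystem {
  ps_uniq : uniq (flatten ps);
  ps_nonnil : [::] \notin ps;
  ps_edges : forall F, (F \in C) = (F \in flatten (map path_edges ps));
  ps_verts : flatten ps =i A;
  ps_kuniq : uniq (unzip1 st);
  ps_keys : {subset unzip1 st <= A};
  ps_mate : forall v w, mate st v = Some w <-> exists2 p, p \in ps & ends p v w;
  ps_deg : forall v, v \in A ->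
    degree C v = if mate st v is Some w then (w != v : nat) else 2 }.

Lemma mem_flatten_of ps p x : p \in ps -> x \in p -> x \in flatten ps.
Proof. by move=> pps xp; apply/flattenP; exists p. Qed.

Lemma mate_key st v w : mate st v = Some w -> v \in unzip1 st.
Proof. by case: (boolP (v \in _)) => // /mate_notin ->. Qed.

Lemma flatten_uniq_inj ps p q x : uniq (flatten ps) ->
  p \in ps -> q \in ps -> x \in p -> x \in q -> p = q.
Proof.
elim: ps => //= r ps IH; rewrite cat_uniq => /and3P[_ /hasPn dis up].
rewrite !inE => /predU1P[->|pps] /predU1P[->|qps] xp xq //; last exact: IH.
- by have := dis _ (mem_flatten_of qps xq); rewrite /= xp.
- by have := dis _ (mem_flatten_of pps xp); rewrite /= xq.
Qed.

Lemma ps_mate_sym ps C A st v w :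
  path_system ps C A st -> mate st v = Some w -> mate st w = Some v.
Proof.
move=> S /(ps_mate S)[p pps vw]; apply/(ps_mate S); exists p => //.
exact: ends_sym.
Qed.

Lemma path_system_perm ps ps' C A st : perm_eq ps ps' ->
  path_system ps C A st -> path_system ps' C A st.
Proof.
move=> ep [U N E V KU K M D]; have pf := perm_flatten ep.
split=> //.
- by rewrite -(perm_uniq pf).
- by rewrite -(perm_mem ep).
- by move=> F; rewrite E; apply: perm_mem; apply: perm_flatten; apply: perm_map.
- by move=> x; rewrite -(perm_mem pf).
- move=> v w; rewrite M; split=> -[p pps e]; exists p => //;
  by rewrite ?(perm_mem ep) // -(perm_mem ep).
Qed.

Lemma system_add ps C A st v : v \notin A -> path_system ps C A st ->
  path_system ([:: v] :: ps) C (v :: A) (rcons st (v, Some v)).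
Proof.
move=> vA [U N E V KU K M D].
have vst : v \notin unzip1 st by apply: contra vA => /K.
split.
- by rewrite /= U V vA.
- by rewrite inE negb_or N.
- by move=> F; rewrite E.
- by move=> x; rewrite /= !inE V.
- by rewrite /unzip1 map_rcons rcons_uniq vst KU.
- by move=> x; rewrite /unzip1 map_rcons mem_rcons !inE => /predU1P[->|/K ->];
    rewrite ?eqxx ?orbT.
- move=> x w; rewrite mate_rcons //; case: (v =P x) => [<-|vx].
    split=> [[<-]|[p]].
      by exists [:: v]; rewrite ?mem_head //; apply/ends_cons; left.
    rewrite inE => /predU1P[->|pps] e; first by case/ends_cons: e => -[_ ->].
    by case/negP: vA; rewrite -V; exact: mem_flatten_of pps (ends_mem e).
  rewrite M; split=> -[p]; first by move=> pps e; exists p; rewrite // inE pps orbT.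
  rewrite inE => /predU1P[->|pps] e; last by exists p.
  by case/ends_cons: e => -[xv _]; case: vx.
- move=> x; rewrite inE mate_rcons //; case: (v =P x) => [<- _|vx].
    rewrite eqxx /degree; apply/eqP; rewrite cards_eq0 -finset.subset0.
    apply/fintype.subsetP => F; rewrite !inE E => /andP[/flattenP[l /mapP[p pps ->]] Fp] vF.
    by case/negP: vA; rewrite -V; exact: mem_flatten_of pps (path_edges_subset Fp vF).
  by case/predU1P => [xv|]; [case: vx | exact: D].
Qed.

Lemma system_drop ps C A st v : mate st v = None -> path_system ps C A st ->
  path_system ps C A (drop_vertex v st).
Proof.
move=> vN [U N E V KU K M D]; have mE w : mate (drop_vertex v st) w = mate st w.
  by rewrite mate_drop; case: (v =P w) => // <-.
split=> //.
- by rewrite unzip1_drop filter_uniq.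
- by move=> x; rewrite unzip1_drop mem_filter => /andP[_ /K].
- by move=> x w; rewrite mE.
- by move=> x; rewrite mE; exact: D.
Qed.

(** Since [a] is not [v], the paths at [u] and [v] differ. With both oriented away from the new
    edge, the merged path is the reverse of the first followed by the second. *)
Lemma system_link ps C A st u v a b : path_system ps C A st ->
  mate st u = Some a -> mate st v = Some b -> a != v -> u != v ->
  [set u; v] \notin C ->
  exists ps', path_system ps' ([set u; v] |: C) A (link u v a b st).
Proof.
move=> S ua vb av uv uvC.
have au := ps_mate_sym S ua; have bv := ps_mate_sym S vb.
have bu : b != u by apply: contra_neq av => bu; rewrite bu in bv; move: bv; rewrite ua => -[].
have ab : a != b by apply: contra_neq uv => ab; move: au; rewrite ab bv => -[].
have [[p pps pe] [q qps qe]] : (exists2 p, p \in ps & ends p u a) /\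
  (exists2 p, p \in ps & ends p v b) by split; apply/(ps_mate S).
have up := ends_mem pe; have vq := ends_mem qe.
(* A path has one pair of ends, so [p = q] would force [u = v] or [a = v]. *)
have pq : p != q.
  apply/eqP => pq; move: qe; rewrite -pq => qe.
  case: p pe qe {pps up pq} => [[s [[//|//]]]|x s].
  move=> /ends_cons pe /ends_cons qe.
  case: pe qe => -[uE aE] [] [vE bE].
  - by move: uv; rewrite uE vE eqxx.
  - by move: av; rewrite aE vE eqxx.
  - by move: av; rewrite aE vE eqxx.
  - by move: uv; rewrite uE vE eqxx.
have [rest pr] : exists rest, perm_eq ps (p :: q :: rest).
  exists (rem q (rem p ps)); apply: (perm_trans (perm_to_rem pps)).
  rewrite perm_cons; apply: perm_to_rem.
  have := perm_mem (perm_to_rem pps) q; rewrite qps inE eq_sym (negPf pq) /=.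
  by move=> <-.
have {}S := path_system_perm pr S.
have [s [sp sl]] := pe; have [t [tq tl]] := qe.
have [U N E V KU K M D] := S.
have pmem : p =i u :: s.
  by case: sp => <- // x; rewrite mem_rev.
have qmem : q =i v :: t.
  by case: tq => <- // x; rewrite mem_rev.
have ppe : path_edges p =i path_edges (u :: s).
  by case: sp => <- // x; rewrite path_edges_rev mem_rev.
have qpe : path_edges q =i path_edges (v :: t).
  by case: tq => <- // x; rewrite path_edges_rev mem_rev.
have pperm : perm_eq p (u :: s) by case: sp => <- //; rewrite perm_sym perm_rev.
have qperm : perm_eq q (v :: t) by case: tq => <- //; rewrite perm_sym perm_rev.
pose r := rev (u :: s) ++ v :: t.
have rE : r = a :: (rev (belast u s) ++ v :: t) by rewrite /r rev_cons_last sl.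
have rends z w : ends r z w <-> (z = a /\ w = b) \/ (z = b /\ w = a).
  have lE : last a (rev (belast u s) ++ v :: t) = b by rewrite last_cat /= tl.
  by rewrite rE; split=> [/ends_cons|h]; [|apply/ends_cons]; rewrite lE.
have flat : perm_eq (flatten (p :: q :: rest)) (flatten (r :: rest)).
  rewrite /= catA perm_cat2r; apply: perm_cat => //.
  by rewrite perm_sym perm_rev perm_sym.
(* The other paths keep their ends, and these avoid all of [a], [b], [u], [v]. *)
have rest_ends z w : (exists2 p0, p0 \in rest & ends p0 z w) <->
    [&& z != a, z != b, z != u & z != v] /\ mate st z = Some w.
  have notin x : x \in p \/ x \in q -> x \notin flatten rest.
    move=> h; move: U; rewrite /= catA cat_uniq => /and3P[_ /hasPn dis _].
    apply/negP => /dis; rewrite /= mem_cat; case: h => ->; rewrite ?orbT //.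
  have ap : a \in p by exact: ends_mem (ends_sym pe).
  have bq : b \in q by exact: ends_mem (ends_sym qe).
  split=> [[p0 p0r e]|[/and4P[za zb zu zv] /M[p0]]].
    have zf := mem_flatten_of p0r (ends_mem e).
    split; last by apply/M; exists p0; rewrite // !inE p0r !orbT.
    by apply/and4P; split; apply/eqP => zE; move: zf; rewrite zE => h;
       [have := notin a (or_introl ap)|have := notin b (or_intror bq)
       |have := notin u (or_introl up)|have := notin v (or_intror vq)]; rewrite h.
  rewrite !inE => /or3P[/eqP ->|/eqP ->|p0r] e; last by exists p0.
  - have := ends_mem e; case: sp => [pE|pE].
      move: e; rewrite pE => /ends_cons[[zE _]|[zE _]] _; move: za zu;
      by rewrite zE ?sl ?eqxx.
    have : ends (rev p) z w by move: e => [s0 h]; exists s0; rewrite revK; tauto.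
    by rewrite pE => /ends_cons[[zE _]|[zE _]] _; move: za zu; rewrite zE ?sl ?eqxx.
  - have := ends_mem e; case: tq => [qE|qE].
      move: e; rewrite qE => /ends_cons[[zE _]|[zE _]] _; move: zb zv;
      by rewrite zE ?tl ?eqxx.
    have : ends (rev q) z w by move: e => [s0 h]; exists s0; rewrite revK; tauto.
    by rewrite qE => /ends_cons[[zE _]|[zE _]] _; move: zb zv; rewrite zE ?tl ?eqxx.
have mE z : mate (link u v a b st) z =
    (if z == a then Some b else if z == b then Some a
     else if (z == u) || (z == v) then None else mate st z).
  rewrite mate_link; case: ifP => // zk.
  have ne w m : mate st w = Some m -> (z == w) = false.
    by move=> /mate_key wk; apply/eqP => zw; rewrite zw wk in zk.
  rewrite (ne a u) // (ne b v) // (ne u a) // (ne v b) //=.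
  by rewrite mate_notin ?zk.
exists (r :: rest); split.
- by rewrite -(perm_uniq flat).
- move: N; rewrite !inE !negb_or => /and3P[_ _ ->]; rewrite andbT.
  by rewrite rE.
- move=> F; rewrite finset.in_setU1 E /= !mem_cat ppe qpe /r rev_cons path_edges_cat.
  rewrite -rev_cons path_edges_rev mem_cat mem_rev inE.
  by case: (F == _); case: (F \in path_edges (u :: s)); case: (F \in path_edges (v :: t)).
- by move=> x; rewrite -(perm_mem flat).
- by rewrite unzip1_link.
- by move=> x; rewrite unzip1_link; exact: K.
- move=> z w; rewrite mE; split.
    case: (z =P a) => [-> [<-]|/eqP za].
      by exists r; [rewrite mem_head|apply/rends; left].
    case: (z =P b) => [-> [<-]|/eqP zb].
      by exists r; [rewrite mem_head|apply/rends; right].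
    case: ifP => // /norP[zu zv] zw.
    have [|p0 p0r e] := (rest_ends z w).2; first by rewrite za zb zu zv.
    by exists p0; rewrite // inE p0r orbT.
  move=> [p0]; rewrite inE => /predU1P[->|p0r] e.
    case/rends: e => -[-> ->]; first by rewrite eqxx.
    by rewrite eqxx eq_sym (negPf ab).
  have [] := (rest_ends z w).1; first by exists p0.
  by move=> /and4P[/negPf-> /negPf-> /negPf-> /negPf->].
- move=> z zA; rewrite degreeU1 // mE D // !inE.
  case: (z =P a) => [->|/eqP za].
    rewrite au (negPf av) orbF [b == a]eq_sym (negPf ab) /= [u == a]eq_sym.
    by case: (a == u).
  case: (z =P b) => [->|/eqP zb].
    rewrite bv (negPf bu) (negPf ab) /= [v == b]eq_sym.
    by case: (b == v).
  case: (z =P u) za => [->|_] za /=; first by rewrite ua [a == u]eq_sym za.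
  case: (z =P v) zb => [->|_] zb /=; first by rewrite vb [b == v]eq_sym zb.
  by rewrite addn0.
Qed.

End PathSystems.

(** * Hamiltonian cycles counted by a sweep *)

Lemma uniq_map_inj (T U : eqType) (f : T -> U) (s : seq T) :
  uniq (map f s) -> {in s &, injective f}.
Proof.
elim: s => //= z s IH /andP[zs us] x y.
rewrite !inE => /predU1P[->|xs] /predU1P[->|ys] // fE; last exact: IH.
- by case/negP: zs; rewrite fE map_f.
- by case/negP: zs; rewrite -fE map_f.
Qed.

Lemma mate_mem (T : eqType) (st : seq (T * option T)) v m :
  uniq (unzip1 st) -> (v, m) \in st -> mate st v = m.
Proof.
elim: st => //= -[u n] st IH /= /andP[ust us]; rewrite inE.
case/predU1P => [[-> ->]|vst]; first by rewrite eqxx.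
case: eqP => [uv|_]; last exact: IH.
by case/negP: ust; rewrite uv; apply/mapP; exists (v, m).
Qed.

Section HamiltonianCycles.
Variable G : sgraph.
Implicit Types (c s : seq G) (p : seq (instr G)) (C : {set {set G}}).
Implicit Types (st : seq (G * option G)).
Local Open Scope set_scope.

Lemma path_edges_frel (f : G -> G) x s : path (frel f) x s ->
  path_edges (x :: s) = [seq [set a; f a] | a <- belast x s].
Proof. by elim: s x => //= y s IH x /andP[/eqP-> /IH <-]. Qed.

Lemma cycle_edgesE (x : G) s F : uniq (x :: s) ->
  (F \in cycle_edges (x :: s)) =
  (F \in rcons (path_edges (x :: s)) [set last x s; x]).
Proof.
move=> us; have := cycle_next us; rewrite /= => cn.
have -> : rcons (path_edges (x :: s)) [set last x s; x] = path_edges (x :: rcons s x).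
  by rewrite /= -!cats1 pairmap_cat.
rewrite (path_edges_frel cn) belast_rcons.
by apply/imsetP/mapP => -[y yc ->]; exists y.
Qed.

Lemma next_neq c x : uniq c -> 2 < size c -> x \in c ->
  next c x != x /\ next c (next c x) != x.
Proof.
move=> uc sc xc; have cn := cycle_next uc.
have := orbit_uniq (next c) x; rewrite /orbit (order_cycle cn uc xc).
case: (size c) sc => [|[|[|n]]] //= _; rewrite !inE !negb_or.
by move=> /andP[/and3P[h1 h2 _] _]; rewrite ![_ == x]eq_sym.
Qed.

(** The edges to the successor and the predecessor differ because a length above 2 gives
    [next c (next c x) != x]. *)
Lemma degree_cycle c x : uniq c -> 2 < size c -> x \in c ->
  degree (cycle_edges c) x = 2.
Proof.
move=> uc sc xc; rewrite /degree.
have -> : [set F in cycle_edges c | x \in F] =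
          [set [set x; next c x]; [set prev c x; x]].
  apply/setP => F; rewrite !inE; apply/andP/orP.
    move=> [/imsetP[y yc ->]]; rewrite !inE => /orP[]/eqP xE.
      by left; rewrite xE.
    by right; rewrite xE prev_next.
  move=> h; split; last by case: h => /eqP ->; rewrite !inE eqxx ?orbT.
  apply/imsetP; case: h => /eqP->; first by exists x.
  by exists (prev c x); rewrite ?mem_prev ?next_prev.
have [h1 h2] := next_neq uc sc xc.
rewrite cards2; case: eqP => // /setP/(_ (next c x)); rewrite !inE eqxx orbT.
rewrite (negPf h1) orbF => /esym/eqP nE; case/eqP: h2.
by rewrite nE next_prev.
Qed.

Lemma cycle_edges_sub c F : F \in cycle_edges c -> exists2 x, x \in F & x \in c.
Proof. by case/imsetP => x xc ->; exists x; rewrite // !inE eqxx. Qed.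

Lemma degree_sub C C' v : C \subset C' -> degree C v = degree C' v ->
  forall F : {set G}, v \in F -> F \in C' -> F \in C.
Proof.
move=> sub e F vF FC'.
have : [set E in C | v \in E] == [set E in C' | v \in E].
  rewrite eqEcard /degree in e *; rewrite e leqnn andbT.
  by apply/fintype.subsetP => E; rewrite !inE => /andP[/(fintype.subsetP sub)-> ->].
by move=> /eqP/setP/(_ F); rewrite !inE FC' vF /= andbT.
Qed.

(** Both cycles have degree 2 at each vertex of [d], so every edge of [c] at such a vertex lies in
    [d]; hence [d] is closed under [next c] and contains all vertices. *)
Lemma subcycle c d : uniq c -> 2 < size c -> uniq d -> 2 < size d ->
  (forall x, x \in c) -> cycle_edges d \subset cycle_edges c ->
  (forall x, x \in d) /\ cycle_edges c = cycle_edges d.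
Proof.
move=> uc sc ud sd call sub.
have step x (F : {set G}) : x \in d -> x \in F -> F \in cycle_edges c -> F \in cycle_edges d.
  by move=> xd; apply: (degree_sub sub); rewrite !degree_cycle.
have dn x : x \in d -> next c x \in d.
  move=> xd; have : [set x; next c x] \in cycle_edges d.
    by apply: (step x); rewrite ?inE ?eqxx //; apply/imsetP; exists x.
  have [nx _] := next_neq uc sc (call x).
  case/imsetP => y yd /setP/(_ (next c x)); rewrite !inE eqxx orbT.
  by move=> /esym/orP[]/eqP ->; rewrite ?mem_next.
have dall y : y \in d.
  case: d ud sd dn {sub step} => // x d ud sd dn.
  have cxy : fconnect (next c) x y.
    by rewrite (fconnect_cycle (cycle_next uc)).
  have walk q w : w \in x :: d -> path (frel (next c)) w q -> last w q \in x :: d.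
    elim: q w => //= z q IH w wd /andP[/eqP <- h]; apply: IH => //; exact: dn.
  by case/connectP: cxy => q xq ->; apply: walk; rewrite ?mem_head.
split=> //; apply/eqP; rewrite finset.eqEsubset sub andbT.
apply/fintype.subsetP => F Fc; have [x xF _] := cycle_edges_sub Fc.
exact: (step x).
Qed.

Definition eset (s : seq (G * G)) : {set {set G}} :=
  [set F in [seq [set e.1; e.2] | e <- s]].

Lemma eset_cons u v (s : seq (G * G)) : eset ((u, v) :: s) = [set u; v] |: eset s.
Proof. by apply/setP => F; rewrite !inE. Qed.

(** That [[set u; v]] is new rules out a path on two vertices, whose closure would be no cycle in a
    simple graph. *)
Lemma path_system_closed ps C A st u v :
  path_system ps C A st -> mate st u = Some v -> u != v -> [set u; v] \notin C ->
  exists q : seq G, [/\ q \in ps, uniq q, 2 < size q &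
    forall F : {set G},
      (F \in cycle_edges q) = (F == [set u; v]) || (F \in path_edges q)].
Proof.
move=> S uv uNv uvC; have [q qps qe] := (ps_mate S u v).1 uv.
have uq : uniq q.
  have := ps_uniq S; elim: ps qps {S} => //= r ps IH.
  rewrite inE cat_uniq => /predU1P[->|h] /and3P[ur _ up] //; exact: IH.
exists q; case: q qe qps uq => [[s [[//|//]]]|x s /ends_cons qe qps uq].
have lE : [set last x s; x] = [set u; v].
  by case: qe => -[-> ->] //; rewrite finset.setUC.
split=> //; last by move=> F; rewrite cycle_edgesE // mem_rcons inE lE.
case: s qe qps uq lE => [|y [|z s]] //= qe qps uq lE.
- by case: qe uNv => -[-> ->]; rewrite eqxx.
- case/negP: uvC; rewrite (ps_edges S) -lE; apply/flattenP.
  exists (path_edges [:: x; y]); first exact: map_f.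
  by rewrite inE finset.setUC.
Qed.

(** Induction over the program with [path_system] as invariant. At the closing edge a single path is
    left and every vertex has been inserted, so the cycle is hamiltonian. *)
Lemma sols_sound p ps C (A : seq G) st (s : seq (G * G)) :
  path_system ps C A st ->
  all (fun e => edge e.1 e.2) (stream_edges p) ->
  uniq [seq [set e.1; e.2] | e <- stream_edges p] ->
  (forall e, e \in stream_edges p -> [set e.1; e.2] \notin C) ->
  uniq (stream_adds p) -> (forall x, x \in stream_adds p -> x \notin A) ->
  (forall x, (x \in A) || (x \in stream_adds p)) ->
  C \subset edges G ->
  s \in sols p st ->
  exists2 c, hamiltonian_seq c & cycle_edges c = C :|: eset s.
Proof.
elim: p ps C A st s => [|[v|u v|v] p IH] ps C A st s //= S ge up nC ua nA cov CG.
- case/andP: ua => va ua; apply: (IH ([:: v] :: ps) C (v :: A)) => //.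
  + by apply: system_add S; apply: nA; rewrite mem_head.
  + move=> x xp; rewrite inE negb_or nA ?inE ?xp ?orbT // andbT.
    by apply: contraNneq va => <-.
  + by move=> x; have := cov x; rewrite !inE; case: (x == v); rewrite ?orbT.
- move: ge up => /= /andP[uvG ge] /andP[uvp up].
  have uvC : [set u; v] \notin C by apply: (nC (u, v)); rewrite mem_head.
  have nC' e : e \in stream_edges p -> [set e.1; e.2] \notin C.
    by move=> ep; apply: nC; rewrite inE ep orbT.
  rewrite mem_cat => /orP[/IH h|/mapP[s' s'P ->]]; first exact: (h ps C A).
  have uNv : u != v by apply: contraTneq uvG => ->; rewrite edge_irr.
  have uvE : [set u; v] \in edges G.
    by rewrite inE; apply/existsP; exists u; apply/existsP; exists v; rewrite uvG eqxx.
  move: s'P; case mu : (mate st u) => [a|] //; case mv : (mate st v) => [b|] //.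
  case: (a =P v) => [av|/eqP av]; last first.
    have [ps' S'] := system_link S mu mv av uNv uvC.
    move=> s'P; have [||c hc cE] := IH ps' _ A _ _ S' ge up _ ua nA cov _ s'P.
    + move=> e ep; rewrite finset.in_setU1 negb_or nC' // andbT.
      by apply: contraNneq uvp => <-; apply/mapP; exists e.
    + by apply/fintype.subsetP => F /setU1P[->|/(fintype.subsetP CG)].
    + exists c; rewrite // cE eset_cons.
      by rewrite finset.setUA [C :|: _]finset.setUC.
  subst a; have [q [qps uq sq qE]] := path_system_closed S mu uNv uvC.
  case: (boolP (_ && _)) => //= /andP[/allP cl na]; rewrite inE => /eqP ->.
  have noadd : stream_adds p = [::].
    by move: na; clear; elim: p => // -[v|u v|v] p IH //=.
  (* [closable] leaves [u] and [v] as the only live ends, and both belong to [q]. *)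
  have one r : r \in ps -> r = q.
    have [U N _ _ _ K M _] := S; case: r => [|x r] rps; first by case/negP: N.
    have xk : mate st x = Some (last x r).
      by apply/M; exists (x :: r); rewrite //; apply/ends_cons; left.
    have := cl (x, mate st x); rewrite /= xk /=.
    have : x \in [:: u; v].
      have: has (fun y => (y.1 == x) && (y.2 == Some (last x r))) st.
        move: xk; clear; elim: st => //= -[y m] st IH /=.
        by case: (y =P x) => [_ ->|_ /IH ->]; rewrite ?eqxx ?orbT.
      case/hasP => -[y m] /cl /= h /andP[/eqP yx /eqP mE]; move: h.
      by rewrite yx mE !inE orbF.
    move=> xuv _; apply: (flatten_uniq_inj (ps_uniq S) rps qps (mem_head x r)).
    have [q' q'ps q'e] := (M u v).1 mu.
    have vu := ps_mate_sym S mu; have [q2 q2ps q2e] := (M v u).1 vu.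
    have u1 : uniq (flatten ps) by exact: U.
    have q'q : q' = q.
      have : [set u; v] \in cycle_edges q by rewrite qE eqxx.
      case/imsetP => y yq /setP/(_ u); rewrite !inE eqxx /= => /esym/orP[]/eqP uE.
        by apply: (flatten_uniq_inj U q'ps qps (ends_mem q'e)); rewrite uE.
      apply: (flatten_uniq_inj U q'ps qps (ends_mem q'e)); rewrite uE mem_next //.
    subst q'; move: xuv; rewrite !inE => /orP[]/eqP ->.
      exact: ends_mem q'e.
    exact: ends_mem (ends_sym q'e).
  have qall x : x \in q.
    have := cov x; rewrite noadd orbF -(ps_verts S).
    by case/flattenP => r rps xr; rewrite -(one r rps).
  have CE F : (F \in C) = (F \in path_edges q).
    rewrite (ps_edges S); apply/flattenP/idP => [[l /mapP[r rps ->]]|Fq].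
      by rewrite (one r rps).
    by exists (path_edges q); first exact: map_f.
  have qEC : cycle_edges q = C :|: eset [:: (u, v)].
    by apply/setP => F; rewrite qE !inE CE orbC.
  exists q => //; rewrite /hamiltonian_seq sq /=; apply/andP; split; last exact/forallP.
  rewrite /ucycleb uq andbT.
  (* Adjacency is recovered from the edge set: [[set x; next q x]] is a graph edge in one of its two
     orientations. *)
  have nextE x : x \in q -> edge x (next q x).
    move=> xq; have : [set x; next q x] \in edges G.
      have : [set x; next q x] \in cycle_edges q by apply/imsetP; exists x.
      rewrite qEC !inE => /orP[/(fintype.subsetP CG)|/eqP ->]; first by rewrite inE.
      by move: uvE; rewrite inE.
    rewrite inE => /existsP[y /existsP[z /andP[yz /eqP /setP xE]]].
    have [nx _] := next_neq uq sq xq.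
    have := xE x; have := xE (next q x); rewrite !inE !eqxx ?orbT /= => h1 h2.
    case/esym/orP: h2 => /eqP xy; case/esym/orP: h1 => /eqP ny.
    + by move: nx; rewrite ny xy eqxx.
    + by rewrite ny xy.
    + by rewrite ny xy edge_sym.
    + by move: nx; rewrite ny xy eqxx.
  apply: (@sub_in_cycle _ (mem q) (frel (next q))); last exact: cycle_next.
  + by move=> x y xq _ /eqP <-; exact: nextE.
  + by apply/allP.
- case mv : (mate st v) => // sP.
  by apply: (IH ps C A (drop_vertex v st)) => //; exact: system_drop.
Qed.

(** The selection dictated by the cycle [c] is never rejected: degree 2 in [c] leaves both ends of a
    selected edge free, makes a vertex interior by the time it is retired, and excludes closing a
    proper subcycle. *)
Lemma sols_complete p ps C (A : seq G) st live c :
  path_system ps C A st -> wf p live -> {subset live <= A} ->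
  uniq [seq [set e.1; e.2] | e <- stream_edges p] ->
  (forall e, e \in stream_edges p -> [set e.1; e.2] \notin C) ->
  uniq (stream_adds p) -> (forall x, x \in stream_adds p -> x \notin A) ->
  (forall x, (x \in A) || (x \in stream_adds p)) ->
  uniq c -> 2 < size c -> (forall x, x \in c) ->
  C \subset cycle_edges c -> cycle_edges c \subset C :|: eset (stream_edges p) ->
  [seq e <- stream_edges p | [set e.1; e.2] \in cycle_edges c] \in sols p st.
Proof.
move=> + + + + + + + + uc sc call.
elim: p ps C A st live => [|[v|u v|v] p IH] ps C A st live S /=.
(* With no edge left to offer, [C] is the whole cycle, yet an end of some path has degree at most
   1. *)
- move=> _ _ _ _ _ _ cov CP PC.
  have CE : C = cycle_edges c.
    apply/eqP; rewrite finset.eqEsubset CP /=; apply: (fintype.subset_trans PC).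
    by apply/fintype.subsetP => F; rewrite !inE orbF.
  have [x xc] : exists x, x \in c by case: (c) sc => // x s _; exists x; rewrite mem_head.
  have xA : x \in A by have := cov x; rewrite orbF.
  move: xA; rewrite -(ps_verts S) => /flattenP[[|y q] qps xq] //.
  have yA : y \in A by have := cov y; rewrite orbF.
  have := ps_deg S yA; have -> : mate st y = Some (last y q).
    by apply/(ps_mate S); exists (y :: q) => //; apply/ends_cons; left.
  by rewrite CE degree_cycle //; case: (_ != _).
- move=> w lA up nC /andP[va ua] nA cov CP PC.
  apply: (IH ([:: v] :: ps) C (v :: A) _ (rcons live v)) => //.
  + by apply: system_add S; apply: nA; rewrite mem_head.
  + by move=> x; rewrite mem_rcons !inE => /predU1P[->|/lA ->]; rewrite ?eqxx ?orbT.
  + move=> x xp; rewrite inE negb_or nA ?inE ?xp ?orbT // andbT.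
    by apply: contraNneq va => <-.
  + by move=> x; have := cov x; rewrite !inE; case: (x == v); rewrite ?orbT.
- move=> /and4P[ul vl uNv w] lA /andP[uvp up] nC ua nA cov CP PC.
  have uvC : [set u; v] \notin C by apply: (nC (u, v)); rewrite mem_head.
  have nC' e : e \in stream_edges p -> [set e.1; e.2] \notin C.
    by move=> ep; apply: nC; rewrite inE ep orbT.
  rewrite mem_cat; case: (boolP ([set u; v] \in _)) => uvP; last first.
    apply/orP; left; apply: (IH ps C A st live) => //.
    apply/fintype.subsetP => F FP; have := fintype.subsetP PC F FP.
    rewrite eset_cons !inE; case: eqP => // FE.
    by move: uvP; rewrite -FE FP.
  apply/orP; right; apply: map_f.
  (* Otherwise [x] would have degree 3 in the cycle: two edges in [C] and [[set u; v]]. *)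
  have some x : x \in live -> x \in [set u; v] -> exists a, mate st x = Some a.
    move=> xl xuv; case mx : (mate st x) => [a|]; first by exists a.
    have := ps_deg S (lA x xl); rewrite mx => d2.
    suff : 3 <= degree (cycle_edges c) x by rewrite degree_cycle.
    have -> : 3 = degree ([set u; v] |: C) x by rewrite degreeU1 // d2 xuv.
    apply: subset_leq_card; apply/fintype.subsetP => F; rewrite !inE => /andP[].
    by move=> /predU1P[->|/(fintype.subsetP CP)->] ->; rewrite ?uvP.
  have [a mu] := some u ul (set21 u v); have [b mv] := some v vl (set22 u v).
  rewrite mu mv; case: (a =P v) => [av|/eqP av]; last first.
    have [ps' S'] := system_link S mu mv av uNv uvC.
    apply: (IH ps' _ A _ live S') => //.
    + move=> e ep; rewrite finset.in_setU1 negb_or nC' // andbT.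
      by apply: contraNneq uvp => <-; apply/mapP; exists e.
    + by apply/fintype.subsetP => F /setU1P[->|/(fintype.subsetP CP)].
    + apply: (fintype.subset_trans PC); rewrite eset_cons finset.setUA [C :|: _]finset.setUC.
      exact: fintype.subxx.
  subst a; have [q [qps uq sq qE]] := path_system_closed S mu uNv uvC.
  have qC F : F \in path_edges q -> F \in C.
    move=> Fq; rewrite (ps_edges S); apply/flattenP.
    by exists (path_edges q); first exact: map_f.
  have qsub : cycle_edges q \subset cycle_edges c.
    by apply/fintype.subsetP => F; rewrite qE => /predU1P[->|/qC/(fintype.subsetP CP)].
  have [qall qeq] := subcycle uc sc uq sq call qsub.
  have noadd : stream_adds p = [::].
    case E : (stream_adds p) => [|x l] //.
    have := nA x; rewrite E mem_head => /(_ isT)/negP; case.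
    by rewrite -(ps_verts S); exact: mem_flatten_of qps (qall x).
  have -> : has (@is_add G) p = false.
    by move: noadd; clear; elim: p => // -[v|u v|v] p IH //=.
  have -> : closable u v st.
    apply/allP => -[x m] xst /=; case: m xst => [w'|] xst; last by rewrite !orbT.
    have [r rps xr] := (ps_mate S x w').1 (mate_mem (ps_kuniq S) xst).
    have [r' r'ps ur'] := (ps_mate S u v).1 mu.
    have rq : r = q by exact: (flatten_uniq_inj (ps_uniq S) rps qps (ends_mem xr)).
    have r'q : r' = q by exact: (flatten_uniq_inj (ps_uniq S) r'ps qps (ends_mem ur')).
    move: ur' xr; rewrite rq r'q; case: (q) => [[l [[//|//]]]|z l].
    move=> /ends_cons h /ends_cons h'; apply/or3P.
    by case: h h' => -[-> ->] [] [-> _]; rewrite eqxx; constructor.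
  (* Nothing is selected after the closure: a later edge of the cycle would be [[set u; v]] again or
     lie in [C]. *)
  rewrite /= inE; apply/eqP; apply/eqP; rewrite -[_ == _]negbK -has_filter.
  apply/negP => /hasP[e ep]; rewrite qeq qE => /predU1P[eE|/qC eC].
    by case/negP: uvp; apply/mapP; exists e.
  by have := nC' e ep; rewrite eC.
- move=> /andP[nt w] lA up nC ua nA cov CP PC.
  (* No later edge touches [v], so both its cycle edges are already in [C]. *)
  have mv : mate st v = None.
    case mv : (mate st v) => [w'|] //.
    have vA := ps_keys S (mate_key mv).
    have := ps_deg S vA; rewrite mv => d1.
    suff : degree (cycle_edges c) v <= degree C v.
      by rewrite degree_cycle // d1; case: (_ != _).
    apply: subset_leq_card; apply/fintype.subsetP => F; rewrite !inE => /andP[FP vF].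
    rewrite vF andbT; have := fintype.subsetP PC F FP; rewrite !inE.
    case/orP => // /mapP[e ep FE]; case/hasP: nt; exists e => //.
    by move: vF; rewrite FE !inE /touches ![v == _]eq_sym.
  by rewrite mv; apply: (IH ps C A _ live) => //; exact: system_drop.
Qed.

Lemma eset_inj (es s s' : seq (G * G)) :
  uniq [seq [set e.1; e.2] | e <- es] -> subseq s es -> subseq s' es ->
  eset s = eset s' -> s = s'.
Proof.
move=> ue ss ss' eE; have inj := uniq_map_inj ue.
have ues : uniq es by exact: map_uniq ue.
have memE t : subseq t es -> {in es, forall e, (e \in t) = ([set e.1; e.2] \in eset t)}.
  move=> st e ees; rewrite inE; apply/idP/mapP => [et|[e' e't /inj ->]] //.
    by exists e.
  exact: mem_subseq st _ e't.
rewrite (subseq_uniqP ues ss) (subseq_uniqP ues ss').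
by apply: eq_in_filter => e ees /=; rewrite (memE s) // (memE s') // eE.
Qed.

Theorem card_hamiltonian_cycles p :
  wf p [::] -> uniq [seq [set e.1; e.2] | e <- stream_edges p] ->
  (forall u v : G, edge u v =
     ((u, v) \in stream_edges p) || ((v, u) \in stream_edges p)) ->
  uniq (stream_adds p) -> (forall x, x \in stream_adds p) ->
  #|hamiltonian_cycles G| = size (sols p [::]).
Proof.
move=> w ue gE ua cov.
have S0 : path_system [::] finset.set0 [::] ([::] : seq (G * option G)).
  by split=> // [F|v w']; [rewrite inE | split=> // -[]].
have ues : uniq (stream_edges p) by exact: map_uniq ue.
have lu : uniq (map eset (sols p [::])).
  rewrite map_inj_in_uniq ?sols_uniq // => s s' sp s'p.
  by apply: (eset_inj ue); apply: sols_subseq; eassumption.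
rewrite -(size_map eset) -(card_uniqP lu); apply: eq_card => P.
apply/imsetP/mapP => [[c]|[s sp ->]].
  rewrite inE => /and3P[sc /andP[cc uc] /forallP call] ->.
  exists [seq e <- stream_edges p | [set e.1; e.2] \in cycle_edges c].
    apply: (@sols_complete p [::] finset.set0 [::] _ [::]) => //.
    - by move=> e _; rewrite inE.
    - exact: finset.sub0set.
    - apply/fintype.subsetP => F /imsetP[x xc ->]; rewrite !inE /=.
      have : edge x (next c x) by exact: next_cycle cc xc.
      rewrite gE => /orP[h|h]; apply/mapP; first by exists (x, next c x).
      by exists (next c x, x); rewrite // finset.setUC.
  apply/setP => F; rewrite inE; apply/idP/mapP => [Fc|[e]]; last first.
    by rewrite mem_filter => /andP[h _] ->.
  case/imsetP: (Fc) => x xc FE.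
  have : edge x (next c x) by exact: next_cycle cc xc.
  rewrite gE => /orP[h|h]; first by exists (x, next c x); rewrite // mem_filter /= -FE Fc.
  exists (next c x, x); last by rewrite /= finset.setUC.
  by rewrite mem_filter /= finset.setUC -FE Fc.
have [] := @sols_sound p [::] finset.set0 [::] [::] s S0 _ ue _ ua _ _ _ sp.
- by apply/allP => e ep; rewrite gE -surjective_pairing ep.
- by move=> e _; rewrite inE.
- by [].
- by move=> x; rewrite cov orbT.
- exact: finset.sub0set.
move=> c hc; rewrite finset.set0U => <-.
case/and3P: (hc) => _ /andP[_ uc] /forallP call.
have sz : size c == #|G|.
  by rewrite -(card_uniqP uc); apply/eqP/eq_card => x; rewrite call.
by exists (Tuple sz); rewrite // inE.
Qed.

End HamiltonianCycles.

(** * Graphs given by edge lists *)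

Definition list_edge (E : seq (nat * nat)) : rel nat :=
  fun i j => (i != j) && (((i, j) \in E) || ((j, i) \in E)).

Lemma list_edge_sym E : symmetric (list_edge E).
Proof. by move=> i j; rewrite /list_edge eq_sym orbC. Qed.

Lemma list_edge_irr E : irreflexive (list_edge E).
Proof. by move=> i; rewrite /list_edge eqxx. Qed.

Definition list_graph (N : nat) (E : seq (nat * nat)) : sgraph :=
  @SGraph 'I_N (fun u v => list_edge E u v)
    (fun u v => list_edge_sym E u v) (fun u => list_edge_irr E u).

Definition ascending (N : nat) (e : nat * nat) := (e.1 < e.2) && (e.2 < N).

Lemma set2_inj_ascending (N : nat) (a b c d : 'I_N) : a < b -> c < d ->
  [set a; b]%SET = [set c; d]%SET -> a = c /\ b = d.
Proof.
move=> ab cd /setP E.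
have := E a; have := E b; rewrite !inE !eqxx ?orbT /= => /esym/orP h1 /esym/orP h2.
case: h2 h1 => /eqP h2 [] /eqP h1; subst => //.
- by rewrite ltnn in ab.
- by have := ltn_trans ab cd; rewrite ltnn.
- by rewrite ltnn in ab.
Qed.

Definition instr_lt (N : nat) (i : instr nat) :=
  match i with
  | Add v => v < N
  | Edge u v => (u < N) && (v < N)
  | Drop v => v < N
  end.

Theorem card_hamiltonian_list_graph (N : nat) (p : seq (instr nat)) :
  0 < N -> all (instr_lt N) p -> wf p [::] -> uniq (stream_edges p) ->
  all (ascending N) (stream_edges p) -> perm_eq (stream_adds p) (iota 0 N) ->
  #|hamiltonian_cycles (list_graph N (stream_edges p))| = size (sols p [::]).
Proof.
move=> N0 pN w ue asc pa.
(* The default [Ordinal N0] is never reached, since all labels of [p] are below [N]. *)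
pose f (v : nat) : 'I_N := insubd (Ordinal N0) v.
pose q := map (instr_map f) p.
have fK v : v < N -> val (f v) = v by move=> h; rewrite val_insubd h.
have qE : map (instr_map val) q = p.
  rewrite {}/q; elim: p pN {w ue asc pa} => //= i p IH /andP[iN /IH ->].
  by case: i iN => [v|u v|v] /=; [move/fK ->|move=> /andP[/fK-> /fK->]|move/fK ->].
have vi : injective (val : 'I_N -> nat) by exact: val_inj.
have esE : stream_edges p = [seq (val e.1, val e.2) | e <- stream_edges q].
  by rewrite -{1}qE stream_edges_map.
have inE' (u v : 'I_N) : ((val u, val v) \in stream_edges p) = ((u, v) \in stream_edges q).
  rewrite esE -(mem_map (f := fun e : 'I_N * 'I_N => (val e.1, val e.2))) //.
  by move=> [a b] [c d] [/vi-> /vi->].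
have -> : size (sols p [::]) = size (sols q [::]).
  by rewrite -(size_sols_map vi q [::]) qE.
apply: (@card_hamiltonian_cycles (list_graph N (stream_edges p)) q).
- by rewrite -(wf_map vi) qE.
- rewrite map_inj_in_uniq; first by move: ue; rewrite esE => /map_uniq.
  have ascq e : e \in stream_edges q -> e.1 < e.2.
    move=> eq; have : (val e.1, val e.2) \in stream_edges p.
      by rewrite inE' -surjective_pairing.
    by move=> /(allP asc) /andP[].
  move=> [a b] [c d] /ascq /= ab /ascq /= cd /(set2_inj_ascending ab cd) [-> ->].
  by [].
- move=> u v; rewrite /= /list_edge !inE'; case: (u =P v) => [->|/eqP uv].
    rewrite eqxx /=; apply/esym/negP => /orP[]; rewrite -inE' => /(allP asc);
    by rewrite /ascending ltnn.
  by have -> : val u != val v by [].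
- by rewrite -(map_inj_uniq vi) -stream_adds_map qE (perm_uniq pa) iota_uniq.
- move=> x; rewrite -(mem_map vi) -stream_adds_map qE (perm_mem pa) mem_iota /=.
  by rewrite add0n ltn_ord.
Qed.

Lemma regular_list_graph (N k : nat) (E : seq (nat * nat)) :
  uniq E -> all (ascending N) E -> (forall v, v < N -> count (touches v) E = k) ->
  regular k (list_graph N E).
Proof.
move=> uE asc deg; rewrite /regular /= => x; rewrite -(deg x (ltn_ord x)).
pose n := nat_of_ord x; rewrite -/n.
(* The neighbours of [x] are the other ends of the edges at [x]; they are distinct because
   [ascending] keeps an edge from being listed in both orientations. *)
pose other (e : nat * nat) := if e.1 == n then e.2 else e.1.
pose l := [seq other e | e <- E & touches n e].
have lu : uniq l.
  rewrite map_inj_in_uniq ?filter_uniq // => -[a b] [c d].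
  rewrite !mem_filter /touches /other /= => /andP[h1 /(allP asc) a1] /andP[h2 /(allP asc) a2].
  move: h1 h2 a1 a2; rewrite /ascending /=.
  case: (a =P n) => [->|_] /=; case: (c =P n) => [->|_] //=.
  + by move=> _ _ _ _ ->.
  + by move=> _ /eqP-> h1 h2 E'; move: h1 h2; rewrite E'; lia.
  + by move=> /eqP-> _ h1 h2 E'; move: h1 h2; rewrite E'; lia.
  + by move=> /eqP-> /eqP-> _ _ ->.
have lN : all (fun y => y < N) l.
  apply/allP => y /mapP[[a b]]; rewrite mem_filter => /andP[_ /(allP asc)] h ->.
  by move: h; rewrite /ascending /other /=; case: ifP => _; lia.
have -> : count (touches n) E = size (pmap insub l : seq 'I_N).
  rewrite size_pmap_sub -size_filter -(size_map other) -/l; apply/esym/eqP.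
  by rewrite -all_count.
rewrite -(card_uniqP (pmap_sub_uniq _ lu)); apply: eq_card => y.
rewrite inE mem_pmap_sub /= /list_edge -/n.
apply/andP/mapP.
  move=> [xy /orP[h|h]].
    by exists (n, val y); rewrite ?mem_filter /touches /other /= ?eqxx ?h.
  exists (val y, n); rewrite ?mem_filter /touches /other /= ?eqxx ?orbT ?h //.
  by rewrite eq_sym (negPf xy).
move=> [[a b]]; rewrite mem_filter /touches /other /= => /andP[t abE] yE.
have := allP asc _ abE; rewrite /ascending /= => ab.
move: t yE; case: (a =P n) => [ax _ yE|_ /= /eqP bx yE].
  by rewrite yE -ax abE; split=> //; lia.
by rewrite yE -bx abE orbT; split=> //; lia.
Qed.

(** * Counting completions with merged states *)

Section WeightedRun.
Variable T : eqType.
Implicit Types (p q : seq (instr T)) (st : seq (T * option T)).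

(* The number of completions depends only on the state, so equal states are
   merged and carry the number of ways in which they arise. *)
Fixpoint insert_weight st (w : N) (l : seq (seq (T * option T) * N)) :=
  match l with
  | [::] => [:: (st, w)]
  | (st', w') :: l' =>
    if st == st' then (st', (w + w')%num) :: l' else (st', w') :: insert_weight st w l'
  end.

(** Selections that close a path are discarded: as long as vertices remain to be inserted, they
    cannot complete a hamiltonian cycle. *)
Definition weighted_step (i : instr T) (l : seq (seq (T * option T) * N)) :=
  match i with
  | Add v => [seq (rcons x.1 (v, Some v), x.2) | x <- l]
  | Drop v =>
    foldr (fun x l' => if mate x.1 v is None
                       then insert_weight (drop_vertex v x.1) x.2 l' else l') [::] l
  | Edge u v =>
    foldr (fun x l' =>
      match mate x.1 u, mate x.1 v with
      | Some a, Some b =>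
        if a == v then l' else (link u v a b x.1, x.2) :: l'
      | _, _ => l'
      end) l l
  end.

Definition weighted_run p l := foldl (fun l i => weighted_step i l) l p.

Definition total q (l : seq (seq (T * option T) * N)) :=
  \sum_(x <- l) N.to_nat x.2 * size (sols q x.1).

Lemma total_insert q st w l :
  total q (insert_weight st w l) = N.to_nat w * size (sols q st) + total q l.
Proof.
elim: l => [|[st' w'] l IH] /=; first by rewrite /total big_seq1 big_nil addn0.
case: eqP => [<-|_]; rewrite /total !big_cons /=.
  by rewrite N2Nat.inj_add plusE mulnDl addnA.
by rewrite -/(total _ _) IH addnCA.
Qed.

Lemma total_step i q l : has (@is_add T) q ->
  total (i :: q) l = total q (weighted_step i l).
Proof.
move=> qa; case: i => [v|u v|v]; first by rewrite /total big_map.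
- transitivity (total q l + \sum_(x <- l) N.to_nat x.2 * size
    match mate x.1 u, mate x.1 v with
    | Some a, Some b => if a == v then [::] else sols q (link u v a b x.1)
    | _, _ => [::]
    end).
    rewrite /total -big_split /=; apply: eq_bigr => x _.
    rewrite size_cat size_map mulnDr; congr (_ + _ * size _).
    case: (mate x.1 u) => // a; case: (mate x.1 v) => // b; case: ifP => //.
    by rewrite qa andbF.
  (* The states that skip the edge form the base of the fold; generalised to [l0], they stay fixed
     while the induction runs over the states that select it. *)
  rewrite /=; move: {1 3}l => l0; elim: l => [|x l IH] /=.
    by rewrite big_nil addn0.
  rewrite big_cons addnCA IH.
  case: (mate x.1 u) => [a|]; last by rewrite muln0.
  case: (mate x.1 v) => [b|]; last by rewrite muln0.
  by case: ifP => _; [rewrite muln0|rewrite /total big_cons].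
- rewrite /=; elim: l => [|x l IH] /=; first by rewrite /total !big_nil.
  rewrite {1}/total big_cons -/(total _ _) IH /=.
  by case: (mate x.1 v) => [a|]; [rewrite muln0|rewrite total_insert].
Qed.

Lemma total_run p q l : has (@is_add T) q ->
  total (p ++ q) l = total q (weighted_run p l).
Proof.
move=> qa; elim: p l => //= i p IH l; rewrite total_step ?IH //.
by rewrite has_cat qa orbT.
Qed.

(* The square of a path has only one way to extend two strands that end at its last two vertices. *)
Lemma zigzag_step (e a b t : T) q : uniq [:: e; a; b; t] -> has (@is_add T) q ->
  size (sols [:: Add t, Edge a t, Edge b t, Drop a & q]
         [:: (e, None); (a, Some b); (b, Some a)]) =
  size (sols q [:: (e, None); (b, Some t); (t, Some b)]).
Proof.
rewrite /= !inE !negb_or => /and4P[/and3P[ea eb et] /andP[ab at'] bt _] qa.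
have [ba ta tb] : [/\ b != a, t != a & t != b] by rewrite ![_ == a]eq_sym [t == b]eq_sym.
have [ae be te] : [/\ a != e, b != e & t != e] by rewrite ![_ == e]eq_sym.
have hE : has (@is_add T) [:: Drop a & q] = true by rewrite /= qa.
(* [Drop a] forces the selection of the edge from [a] to [t]; after it, the edge from [b] to [t]
   would close the cycle too early. One selection survives. *)
do !rewrite ?(negPf ea) ?(negPf eb) ?(negPf et) ?(negPf ab) ?(negPf at') ?(negPf bt)
  ?(negPf ba) ?(negPf ta) ?(negPf tb) ?(negPf ae) ?(negPf be) ?(negPf te) ?eqxx
  ?cats0 ?qa ?andbF ?size_cat ?size_map /=.
by [].
Qed.

End WeightedRun.

(** * The family of graphs *)

(* Vertices [0 .. r-1] form the right cap and [r .. B-1] the left cap; the strip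
   continues [B-2, B-1] with new vertices, and the right cap is attached to the
   last two vertices of the strip and, by a single edge, to the vertex [cap_e]
   of the left cap. *)
Record caps := Caps {
  cap_r : nat;
  cap_B : nat;
  cap_e : nat;
  cap_L : seq (instr nat);
  cap_R : seq (instr nat) }.

Definition strip_at (t : nat) : seq (instr nat) :=
  [:: Add t; Edge (t - 2) t; Edge (t - 1) t; Drop (t - 2)].

Definition strip (B n : nat) := flatten [seq strip_at t | t <- iota B n].

(* In the edges of the right cap, [B-2] and [B-1] stand for the last two vertices
   of the strip. *)
Definition shift (B n v : nat) := if v < B - 2 then v else v + n.

Definition family_stream (c : caps) (n : nat) :=
  cap_L c ++ strip (cap_B c) n ++ map (instr_map (shift (cap_B c) n)) (cap_R c).

Definition family (c : caps) (n : nat) : sgraph :=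
  list_graph (cap_B c + n) (stream_edges (family_stream c n)).

(* The only state in which a sweep can leave the left cap: [e] is interior to a
   path, so its edge to the right cap is unusable, and [B-2], [B-1] are the ends
   of one spanning path. *)
Definition strands (e B : nat) : seq (nat * option nat) :=
  [:: (e, None); (B - 2, Some (B - 1)); (B - 1, Some (B - 2))].

(** Finite facts, all decided by evaluation. [spec_deg] says that the caps glued without a strip are
    4-regular; [spec_degL] gives the degrees 3 and 2 that the last two vertices of a strip also have
    before the right cap is attached. By [spec_run] the left cap admits one final state, reached by
    [w] selections. *)
Record caps_spec (c : caps) (w : N) (m : nat) : Prop := CapsSpec {
  spec_r : [&& 2 < cap_r c, cap_r c <= cap_e c, cap_e c < cap_B c - 2 &
               (cap_r c).+1 < cap_B c - 2];
  spec_addsL : perm_eq (stream_adds (cap_L c)) (iota (cap_r c) (cap_B c - cap_r c));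
  spec_addsR : perm_eq (stream_adds (cap_R c)) (iota 0 (cap_r c));
  spec_edgesL : all (fun x => [&& cap_r c <= x.1, x.1 < x.2 & x.2 < cap_B c])
                    (stream_edges (cap_L c));
  spec_uniqL : uniq (stream_edges (cap_L c));
  spec_edgesR : all (fun x => [&& x.1 < cap_r c, x.1 < x.2 &
      [|| x.2 < cap_r c, x.2 == cap_e c, x.2 == cap_B c - 2 | x.2 == cap_B c - 1]])
                    (stream_edges (cap_R c));
  spec_uniqR : uniq (stream_edges (cap_R c));
  spec_wfL : wf (cap_L c) [::];
  spec_dropsL : all (fun v => [&& cap_r c <= v, v < cap_B c - 2 & v != cap_e c])
                    (stream_drops (cap_L c));
  spec_wfR : wf (cap_R c) [:: cap_e c; cap_B c - 2; cap_B c - 1];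
  spec_dropsR : stream_drops (cap_R c) = [::];
  spec_deg : all (fun v => count (touches v)
      (stream_edges (cap_L c) ++ stream_edges (cap_R c)) == 4) (iota 0 (cap_B c));
  spec_degL : (count (touches (cap_B c - 2)) (stream_edges (cap_L c)) == 3) &&
              (count (touches (cap_B c - 1)) (stream_edges (cap_L c)) == 2);
  spec_run : weighted_run (map (instr_map N.of_nat) (cap_L c)) [:: ([::], 1%num)] =
             [:: (st_map N.of_nat (strands (cap_e c) (cap_B c)), w)];
  spec_sols : size (sols (cap_R c) (strands (cap_e c) (cap_B c))) = m }.

Lemma strip_recl B n : strip B n.+1 = strip_at B ++ strip B.+1 n.
Proof. by []. Qed.

Lemma strip_edgesS B n :
  stream_edges (strip B n.+1) = (B - 2, B) :: (B - 1, B) :: stream_edges (strip B.+1 n).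
Proof. by rewrite strip_recl stream_edges_cat. Qed.

Lemma mem_strip_edges B n (a b : nat) : 1 < B -> ((a, b) \in stream_edges (strip B n)) =
  [&& B <= b, b < B + n & (a == b - 2) || (a == b - 1)].
Proof.
elim: n B => [|n IH] B B1; first by rewrite in_nil; lia.
rewrite strip_edgesS !inE IH; last by lia.
by rewrite !xpair_eqE /=; lia.
Qed.

Lemma strip_edges_uniq B n : 1 < B -> uniq (stream_edges (strip B n)).
Proof.
elim: n B => // n IH B B1; rewrite strip_edgesS /= !inE !mem_strip_edges; [|lia..].
by rewrite IH; [rewrite !xpair_eqE /=; lia | lia].
Qed.

(** The summands count the edges to the two predecessors, to [v.+1] and to [v.+2]. *)
Lemma count_strip_edges B n v : 1 < B -> count (touches v) (stream_edges (strip B n)) =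
  2 * ((B <= v) && (v < B + n)) + ((B <= v.+1) && (v.+1 < B + n)) +
  ((B <= v.+2) && (v.+2 < B + n)).
Proof.
elim: n B => [|n IH] B B1; first by rewrite /=; lia.
by rewrite strip_edgesS /= IH /touches /=; lia.
Qed.

Lemma strip_adds B n : stream_adds (strip B n) = iota B n.
Proof. by elim: n B => // n IH B; rewrite strip_recl stream_adds_cat IH. Qed.

Lemma strip_drops B n : stream_drops (strip B n) = [seq t - 2 | t <- iota B n].
Proof. by elim: n B => // n IH B; rewrite /= -IH. Qed.

Lemma strip_wf B n : 1 < B -> wf (strip B n) [:: B - 2; B - 1].
Proof.
elim: n B => // n IH B B1; rewrite strip_recl; apply: (wf_cat (live' := [:: B - 1; B])).
- by rewrite /= !inE !eqxx ?orbT /=; lia.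
- rewrite /= andbT; apply/hasPn => -[a b]; rewrite mem_strip_edges; last by lia.
  by rewrite /touches /=; lia.
- by move=> x; rewrite !inE; lia.
- have E1 : B.+1 - 2 = B - 1 by lia.
  have E2 : B.+1 - 1 = B by lia.
  by have := IH B.+1; rewrite E1 E2; apply; lia.
Qed.

Lemma strip_sols e B n q : e < B - 2 -> has (@is_add _) q ->
  size (sols (strip B n ++ q) (strands e B)) = size (sols q (strands e (B + n))).
Proof.
elim: n B => [|n IH] B eB qa; first by rewrite addn0.
rewrite strip_recl -catA [strip_at B ++ _]/= zigzag_step.
- have <- : strands e B.+1 = [:: (e, None); (B - 1, Some B); (B, Some (B - 1))].
    have E1 : B.+1 - 2 = B - 1 by lia.
    have E2 : B.+1 - 1 = B by lia.
    by rewrite /strands E1 E2.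
  by rewrite IH ?addSnnS //; lia.
- by rewrite /= !inE; lia.
- by rewrite has_cat qa orbT.
Qed.

Lemma shift_inj B n : injective (shift B n).
Proof. by move=> u v; rewrite /shift; do 2 case: ifP; lia. Qed.

Section Family.
Variables (c : caps) (w : N) (m : nat).
Hypothesis spec : caps_spec c w m.
Local Notation r := (cap_r c).
Local Notation B := (cap_B c).
Local Notation e := (cap_e c).

Let bounds : [&& 2 < r, r <= e, e < B - 2 & r.+1 < B - 2]. Proof. exact: spec_r spec. Qed.

Lemma family_edgesE n : stream_edges (family_stream c n) =
  stream_edges (cap_L c) ++ stream_edges (strip B n) ++
  [seq (shift B n x.1, shift B n x.2) | x <- stream_edges (cap_R c)].
Proof. by rewrite /family_stream !stream_edges_cat stream_edges_map. Qed.

Lemma shifted_edgesR n (a b : nat) :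
  (a, b) \in [seq (shift B n x.1, shift B n x.2) | x <- stream_edges (cap_R c)] ->
  [&& a < r, a < b & [|| b < r, b == e, b == B + n - 2 | b == B + n - 1]].
Proof.
move=> /mapP[[u v] /(allP (spec_edgesR spec)) /= h [-> ->]]; have := bounds.
by rewrite /shift; case: ifP; case: ifP; lia.
Qed.

Lemma family_edges_uniq n : uniq (stream_edges (family_stream c n)).
Proof.
have bd := bounds; rewrite family_edgesE !cat_uniq (spec_uniqL spec).
rewrite strip_edges_uniq; last by lia.
rewrite map_inj_uniq ?(spec_uniqR spec) ?andbT; last first.
  by move=> [a b] [a' b'] [/shift_inj-> /shift_inj->].
apply/and3P; split=> //; apply/hasPn => -[a b].
  rewrite mem_cat; apply: contraL => /(allP (spec_edgesL spec)) /= h.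
  rewrite negb_or mem_strip_edges; last by lia.
  apply/andP; split; first by lia.
  by apply/negP => /shifted_edgesR; lia.
move=> /shifted_edgesR h; rewrite mem_strip_edges; last by lia.
lia.
Qed.

Lemma family_ascending n : all (ascending (B + n)) (stream_edges (family_stream c n)).
Proof.
have bd := bounds; rewrite family_edgesE !all_cat; apply/and3P; split; apply/allP => -[a b].
- by move=> /(allP (spec_edgesL spec)) /=; rewrite /ascending /=; lia.
- by rewrite mem_strip_edges; rewrite /ascending /=; lia.
- by move=> /shifted_edgesR; rewrite /ascending /=; lia.
Qed.

Lemma family_wf n : wf (family_stream c n) [::].
Proof.
have bd := bounds.
apply: (wf_cat (live' := iota r (B - r))); first exact: spec_wfL spec.
- apply/allP => v /(allP (spec_dropsL spec)) /= h; rewrite stream_edges_cat has_cat.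
  rewrite negb_or stream_edges_map; apply/andP; split; apply/hasPn => -[a b].
    by rewrite mem_strip_edges; rewrite /touches /=; lia.
  by move=> /shifted_edgesR; rewrite /touches /=; lia.
- by move=> x; rewrite cat0s (perm_mem (spec_addsL spec)).
apply: (wf_cat (live' := [:: e; B + n - 2; B + n - 1])).
- apply: (@wf_cat _ [::] _ _ [:: B - 2; B - 1]) => //; last by apply: strip_wf; lia.
  by move=> x; rewrite cats0 !inE mem_iota; lia.
- rewrite strip_drops stream_edges_map; apply/allP => v /mapP[t]; rewrite mem_iota.
  move=> tB ->; apply/hasPn => -[a b] /shifted_edgesR; rewrite /touches /=; lia.
- by move=> x; rewrite !inE mem_cat strip_adds !mem_iota; lia.
have -> : [:: e; B + n - 2; B + n - 1] = map (shift B n) [:: e; B - 2; B - 1].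
  by rewrite /= /shift; do ?case: ifP; try lia; move=> *; congr [:: _; _; _]; lia.
by rewrite wf_map ?(spec_wfR spec) //; exact: shift_inj.
Qed.

Lemma family_adds n : perm_eq (stream_adds (family_stream c n)) (iota 0 (B + n)).
Proof.
have bd := bounds; rewrite /family_stream !stream_adds_cat strip_adds stream_adds_map.
have -> : B + n = r + ((B - r) + n) by lia.
rewrite !iotaD add0n perm_sym perm_catC perm_sym -catA.
apply: perm_cat; first exact: spec_addsL spec.
rewrite (_ : r + (B - r) = B); last by lia.
rewrite perm_cat2l; apply: (perm_trans (perm_map _ (spec_addsR spec))).
rewrite (_ : map _ _ = iota 0 r) //; rewrite -[RHS]map_id; apply/eq_in_map => x.
by rewrite mem_iota /shift; case: ifP; lia.
Qed.

Lemma family_instr_lt n : all (instr_lt (B + n)) (family_stream c n).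
Proof.
suff gen p : all (fun v => v < B + n) (stream_adds p) ->
    all (ascending (B + n)) (stream_edges p) ->
    all (fun v => v < B + n) (stream_drops p) -> all (instr_lt (B + n)) p.
  apply: gen; last first.
  - have bd := bounds; rewrite /family_stream; set p := strip _ _ ++ _.
    have dc (q q' : seq (instr nat)) :
        stream_drops (q ++ q') = stream_drops q ++ stream_drops q'.
      by elim: q => [|[v|u v|v] q IH] //=; rewrite IH.
    rewrite dc /p dc stream_drops_map (spec_dropsR spec) cats0 strip_drops all_cat.
    apply/andP; split; apply/allP => v.
      by move=> /(allP (spec_dropsL spec)) /=; lia.
    by move=> /mapP[t]; rewrite mem_iota => ? ->; lia.
  - exact: family_ascending.
  - by apply/allP => v; rewrite (perm_mem (family_adds n)) mem_iota.
elim: p => [|[v|u v|v] p IH] //=.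
- by move=> /andP[-> /IH h]; exact: h.
- by move=> h1 /andP[h h2] h3; rewrite IH // andbT; move: h; rewrite /ascending /=; lia.
- by move=> h1 h2 /andP[-> h3]; exact: IH.
Qed.

Theorem family_hamiltonian n :
  #|hamiltonian_cycles (family c n)| = N.to_nat w * m.
Proof.
have bd := bounds; rewrite card_hamiltonian_list_graph ?family_instr_lt //; first last.
- exact: family_adds.
- exact: family_ascending.
- exact: family_edges_uniq.
- exact: family_wf.
- by lia.
pose R' := map (instr_map (shift B n)) (cap_R c).
have aR : has (@is_add _) R'.
  have : stream_adds R' != [::].
    rewrite stream_adds_map -size_eq0 size_map (perm_size (spec_addsR spec)) size_iota.
    by lia.
  by elim: R' => [|[v|u v|v] q IH] //=.
pose q := strip B n ++ R'; have aq : has (@is_add _) q by rewrite has_cat aR orbT.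
have Ninj : injective N.of_nat by exact: Nnat.Nat2N.inj.
(* Labels become binary numbers here because [spec_run] is evaluated over [N]. *)
rewrite /family_stream -/R' -/q -(size_sols_map Ninj _ [::]) map_cat.
set qN := map _ q; have aN : has (@is_add _) qN by rewrite has_map; apply: etrans aq; apply: eq_has => -[].
have -> : size (sols (map (instr_map N.of_nat) (cap_L c) ++ qN) (st_map N.of_nat [::])) =
          total (map (instr_map N.of_nat) (cap_L c) ++ qN) [:: ([::], 1%num)].
  by rewrite /total big_seq1 /= mul1n.
rewrite total_run // (spec_run spec).
have -> : total qN [:: (st_map N.of_nat (strands e B), w)] =
          N.to_nat w * size (sols qN (st_map N.of_nat (strands e B))).
  by rewrite /total big_seq1.
rewrite size_sols_map //; congr (_ * _).
rewrite strip_sols //; last by lia.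
have -> : strands e (B + n) = st_map (shift B n) (strands e B).
  rewrite /strands /st_map /= /shift; do ?case: ifP; try lia.
  by move=> *; congr [:: _; (_, Some _); (_, Some _)]; lia.
by rewrite size_sols_map ?(spec_sols spec) //; exact: shift_inj.
Qed.

(** [B-2] and [B-1] have 3 and 2 edges in the left cap and receive 1 and 2 from the strip. The last
    two strip vertices again have strip degrees 3 and 2, so the right cap completes them as it would
    complete [B-2] and [B-1]. *)
Theorem family_regular n : 1 < n -> regular 4 (family c n).
Proof.
move=> n1; have bd := bounds.
apply: regular_list_graph; [exact: family_edges_uniq|exact: family_ascending|].
move=> v vN; rewrite family_edgesE !count_cat count_strip_edges; last by lia.
have cR u : count (touches (shift B n u))
   [seq (shift B n x.1, shift B n x.2) | x <- stream_edges (cap_R c)] =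
   count (touches u) (stream_edges (cap_R c)).
  rewrite count_map; apply: eq_count => x; rewrite /touches /= !inj_eq //; exact: shift_inj.
have deg u : u < B -> count (touches u) (stream_edges (cap_L c)) +
    count (touches u) (stream_edges (cap_R c)) = 4.
  move=> uB; have := allP (spec_deg spec) u; rewrite mem_iota count_cat => /(_ uB).
  by move/eqP.
have /andP[/eqP dy /eqP dx] := spec_degL spec.
have Ry := deg (B - 2); have Rx := deg (B - 1).
have L0 u : B <= u -> count (touches u) (stream_edges (cap_L c)) = 0.
  move=> Bu; apply/eqP; rewrite -leqn0 leqNgt -has_count; apply/hasPn => -[a b].
  by move=> /(allP (spec_edgesL spec)) /=; rewrite /touches /=; lia.
have R0 u : B - 2 <= u -> u < B + n - 2 -> count (touches u)
   [seq (shift B n x.1, shift B n x.2) | x <- stream_edges (cap_R c)] = 0.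
  move=> h1 h2; apply/eqP; rewrite -leqn0 leqNgt -has_count; apply/hasPn => -[a b].
  by move=> /shifted_edgesR; rewrite /touches /=; lia.
case: (ltnP v (B - 2)) => vB.
  have := cR v; rewrite {1}/shift vB => ->; have := deg v; lia.
case: (ltnP v (B + n - 2)) => vR.
  rewrite R0 //; case: (v =P B - 2) => [->|?]; first by rewrite dy; lia.
  case: (v =P B - 1) => [->|?]; first by rewrite dx; lia.
  by rewrite L0; lia.
rewrite L0; last by lia.
case: (v =P B + n - 2) => [->|?].
  have := cR (B - 2); rewrite {1}/shift ltnn.
  rewrite (_ : B - 2 + n = B + n - 2); last by lia.
  by move=> ->; lia.
have -> : v = B + n - 1 by lia.
have := cR (B - 1); rewrite {1}/shift; case: ifP; first by lia.
move=> _; rewrite (_ : B - 1 + n = B + n - 1); last by lia.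
by move=> ->; lia.
Qed.

Lemma family_not_iso i j : i <> j -> ~ graph_iso (family c i) (family c j).
Proof.
move=> ij [f [/bij_eq_card]]; rewrite !card_ord => /addnI /ij //.
Qed.

End Family.

(** * Connectivity of the family *)

Definition avoiding (G : sgraph) (S : {set G}) : rel G :=
  [rel u v | [&& edge u v, u \notin S & v \notin S]].

Lemma avoiding_sym (G : sgraph) (S : {set G}) : connect_sym (avoiding S).
Proof.
apply: sym_connect_sym => u v; rewrite /avoiding /= edge_sym.
by congr (_ && _); rewrite andbC.
Qed.

(** For a contraction [f] with representatives [g]: a path in [H] is lifted edge by edge to walks
    that avoid [S]. The first hypothesis forbids identifying a vertex outside [S] with one
    inside. *)
Lemma connected_without_lift (G H : sgraph) (S : {set G}) (f : G -> H) (g : H -> G) :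
  (forall x, x \notin S -> f x \notin f @: S) ->
  (forall x, x \notin S -> connect (avoiding S) x (g (f x))) ->
  (forall a b, a \notin f @: S -> b \notin f @: S -> edge a b ->
     connect (avoiding S) (g a) (g b)) ->
  connected_without (f @: S) -> connected_without S.
Proof.
move=> fS gf lift /forallP cH; apply/forallP => x; apply/forallP => y.
apply/implyP => /andP[xS yS].
have /forallP/(_ (f y))/implyP := cH (f x); rewrite !fS // => /(_ isT).
move=> /connectP[p pH fyE]; change (connect (avoiding S) x y).
apply: (connect_trans (gf x xS)).
have gy : connect (avoiding S) (g (f y)) y by rewrite avoiding_sym; exact: gf.
apply: connect_trans gy.
rewrite fyE; elim: p (f x) pH {fyE} => [|b p IH] a /=; first by rewrite connect0.
move=> /andP[/and3P[ab aS bS] pH].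
by apply: connect_trans (IH _ pH); exact: lift.
Qed.

(* Vertex sets are encoded as bit masks. *)
Definition bit (v : nat) : N := N.setbit 0 (N.of_nat v).

Definition edge_mask (x : nat * nat) : N := N.lor (bit x.1) (bit x.2).

Definition mark_edge (vis x : N) : N :=
  if N.eqb (N.land x vis) 0 then vis else N.lor vis x.

Fixpoint spreads (k : nat) (full S : N) (E : seq N) (vis : N) : bool :=
  if k is k'.+1 then
    let vis' := foldl mark_edge vis E in
    if N.eqb (N.lor vis' S) full then true else spreads k' full S E vis'
  else false.

Definition root_avoiding (a b : nat) : nat :=
  if (a != 0) && (b != 0) then 0 else if (a != 1) && (b != 1) then 1 else 2.

(** [a] and [b] may equal [n], which is no vertex, so the mask to be filled is [N.ones] together
    with [S]. *)
Definition connected_check (n : nat) (E : seq N) (a b : nat) : bool :=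
  let S := N.lor (bit a) (bit b) in
  spreads n (N.lor (N.ones (N.of_nat n)) S) S [seq x <- E | N.eqb (N.land x S) 0]
    (bit (root_avoiding a b)).

(** The pair [(n, n)] stands for the empty separator and [(a, a)] for a single vertex, so pairs
    cover all sets of fewer than three vertices. *)
Definition three_connected_check (n : nat) (E : seq (nat * nat)) : bool :=
  let E' := map edge_mask E in
  all (fun a => all (connected_check n E' a) (iota a (n.+1 - a))) (iota 0 n.+1).

Lemma testbit_bit u v : N.testbit (bit u) (N.of_nat v) = (u == v).
Proof.
rewrite N.setbit_eqb N.bits_0 orbF; apply/idP/eqP => [/N.eqb_eq/Nnat.Nat2N.inj //|->].
exact: N.eqb_refl.
Qed.

Lemma land_eq0 x y v : N.land x y = 0%num -> N.testbit x v -> N.testbit y v = false.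
Proof.
by move=> h xv; have := N.land_spec x y v; rewrite h N.bits_0 xv /= => ->.
Qed.

Lemma land_edge_mask u v y : ~~ N.eqb (N.land (edge_mask (u, v)) y) 0 ->
  N.testbit y (N.of_nat u) || N.testbit y (N.of_nat v).
Proof.
apply: contraR => /norP[yu yv]; apply/N.eqb_eq; apply: N.bits_inj => k.
rewrite N.land_spec N.lor_spec N.bits_0 -(Nnat.N2Nat.id k) !testbit_bit /=.
by case: eqP => [<-|_] /=; [exact/negbTE | case: eqP => [<-|_] //=; exact/negbTE].
Qed.

Lemma connected_check_sound n E a b : 2 < n -> all (ascending n) E ->
  connected_check n (map edge_mask E) a b ->
  connected_without ([set x : list_graph n E | (val x == a) || (val x == b)])%SET.
Proof.
move=> n2 asc; rewrite /connected_check.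
pose S := ([set x : list_graph n E | (val x == a) || (val x == b)])%SET; rewrite -/S.
set SM := N.lor (bit a) (bit b); set r := root_avoiding a b.
set E' := [seq x <- _ | _].
have SME (i : nat) : N.testbit SM (N.of_nat i) = (i == a) || (i == b).
  by rewrite N.lor_spec !testbit_bit ![_ == i]eq_sym.
have rn : r < n by rewrite /r /root_avoiding; do 2?case: ifP; lia.
pose root : list_graph n E := Ordinal rn.
have rS : root \notin S.
  by rewrite inE /=; rewrite /r /root_avoiding; do 2?case: ifP; lia.
(* The invariant of the search: marked vertices are reachable from the root outside [S]. *)
pose good vis := forall i : list_graph n E,
  N.testbit vis (N.of_nat (val i)) -> i \notin S /\ connect (avoiding S) root i.
have g0 : good (bit r).
  move=> i; rewrite testbit_bit => /eqP ri.
  have -> : i = root by apply: val_inj.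
  by split=> //; exact: connect0.
have gstep vis : good vis -> good (foldl mark_edge vis E').
  have : {subset E' <= E'} by [].
  elim: {1 3}E' vis => //= x l IH vis sub gv.
  apply: IH; first by move=> y yl; apply: sub; rewrite inE yl orbT.
  have : x \in E' by apply: sub; rewrite mem_head.
  rewrite mem_filter => /andP[/N.eqb_eq xS /mapP[[u v] uvE xE]].
  rewrite /mark_edge; case: ifP => // /negbT; rewrite xE => /land_edge_mask h.
  have := allP asc _ uvE; rewrite /ascending /= => /andP[uv vn].
  have un : u < n by exact: ltn_trans vn.
  pose u' : list_graph n E := Ordinal un; pose v' : list_graph n E := Ordinal vn.
  have u'S : u' \notin S.
    rewrite inE /= -SME; apply/negbT/(land_eq0 xS).
    by rewrite xE N.lor_spec !testbit_bit eqxx.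
  have v'S : v' \notin S.
    rewrite inE /= -SME; apply/negbT/(land_eq0 xS).
    by rewrite xE N.lor_spec !testbit_bit eqxx orbT.
  have e1 : avoiding S u' v'.
    by apply/and3P; split=> //; rewrite /= /list_edge /= uvE /= andbT; lia.
  have [cu cv] : connect (avoiding S) root u' /\ connect (avoiding S) root v'.
    case/orP: h => h.
      have cu := (gv u' h).2; split=> //; exact: connect_trans cu (connect1 e1).
    have cv := (gv v' h).2; split=> //; apply: (connect_trans cv).
    by rewrite avoiding_sym; exact: connect1.
  move=> i; rewrite !N.lor_spec !testbit_bit => /or3P[/gv //|/eqP ui|/eqP vi].
    by have -> : i = u' by apply: val_inj.
  by have -> : i = v' by apply: val_inj.
have reach k vis : good vis -> spreads k (N.lor (N.ones (N.of_nat n)) SM) SM E' vis ->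
    forall x : list_graph n E, x \notin S -> connect (avoiding S) root x.
  elim: k vis => //= k IH vis /gstep gv; case: ifP => [/N.eqb_eq vE _ x xS|_]; last exact: IH.
  apply: (gv x _).2; have := congr1 (N.testbit ^~ (N.of_nat (val x))) vE.
  rewrite /= !(N.lor_spec _ SM) SME; move: xS; rewrite inE => /negPf ->.
  rewrite !orbF => ->; apply/N.ones_spec_iff.
  by have := ltn_ord x; lia.
move=> /(reach _ _ g0) {}reach.
apply/forallP => x; apply/forallP => y; apply/implyP => /andP[xS yS].
change (connect (avoiding S) x y).
by apply: connect_trans (reach y yS); rewrite avoiding_sym; exact: reach.
Qed.

Lemma three_connected_check_sound n E : 3 < n -> all (ascending n) E ->
  three_connected_check n E -> k_connected 3 (list_graph n E).
Proof.
move=> n3 asc /allP chk; rewrite /k_connected card_ord n3 /=.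
have pair a b : a <= n -> b <= n ->
    connected_without [set x : list_graph n E | (val x == a) || (val x == b)]%SET.
  wlog ab : a b / a <= b => [h an bn|an bn].
    case/orP: (leq_total a b) => ab; first exact: h.
    rewrite (_ : [set x | _]%SET = [set x : list_graph n E | (val x == b) || (val x == a)]%SET).
      exact: h.
    by apply/setP => x; rewrite !inE orbC.
  apply: connected_check_sound => //; first by lia.
  have := chk a; rewrite mem_iota => /(_ _)/allP h; apply: h; first by lia.
  by rewrite mem_iota; lia.
apply/forallP => S; apply/implyP; rewrite ltnS.
case: (posnP #|S|) => [/eqP|S0 S2].
  rewrite cards_eq0 => /eqP -> _.
  rewrite (_ : finset.set0 = [set x : list_graph n E | (val x == n) || (val x == n)]%SET).
    exact: pair.
  apply/setP => x; rewrite !inE orbb; apply/esym/negP => /eqP xn.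
  by have := ltn_ord x; rewrite -[X in _ < X]xn ltnn.
have [/eqP/cards1P[x ->]|S1] := eqVneq #|S| 1.
  rewrite (_ : [set x]%SET = [set y : list_graph n E | (val y == val x) || (val y == val x)]%SET).
    by apply: pair; apply: ltnW; exact: ltn_ord.
  by apply/setP => y; rewrite !inE orbb.
have /cards2P[x [y [xy ->]]] : #|S| == 2.
  by move: S0 S1 S2; case: #|S| => [|[|[|k]]].
rewrite (_ : [set x; y]%SET = [set z : list_graph n E | (val z == val x) || (val z == val y)]%SET).
  by apply: pair; apply: ltnW; exact: ltn_ord.
by apply/setP => z; rewrite !inE.
Qed.

(** Contraction of [p.+1] onto [p], with renumbering; [stretch] is its section that skips [p.+1]. *)
Definition squeeze (p v : nat) := if v <= p then v else v.-1.
Definition stretch (p v : nat) := if v <= p then v else v.+1.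

Lemma stretchK p : cancel (stretch p) (squeeze p).
Proof.
by move=> v; rewrite /squeeze /stretch; case: (leqP v p) => h; rewrite ?h //; case: ifP; lia.
Qed.

Lemma squeezeK p v : v != p.+1 -> stretch p (squeeze p v) = v.
Proof.
by rewrite /squeeze /stretch; case: (leqP v p) => h; rewrite ?h //; case: ifP; lia.
Qed.

(** * Three-connectivity by contracting strip edges, and the 3-cut *)

Section FamilyConnectivity.
Variables (c : caps) (w : N) (m : nat).
Hypothesis spec : caps_spec c w m.
Local Notation r := (cap_r c).
Local Notation B := (cap_B c).
Local Notation e := (cap_e c).
Local Notation E n := (stream_edges (family_stream c n)).

Let bounds : [&& 2 < r, r <= e, e < B - 2 & r.+1 < B - 2]. Proof. exact: spec_r spec. Qed.

Lemma mem_family_edges n (a b : nat) : (a, b) \in E n =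
  [|| (a, b) \in stream_edges (cap_L c),
      [&& B <= b, b < B + n & (a == b - 2) || (a == b - 1)] |
      (a, b) \in [seq (shift B n x.1, shift B n x.2) | x <- stream_edges (cap_R c)]].
Proof.
have bd := bounds; rewrite family_edgesE !mem_cat mem_strip_edges //; lia.
Qed.

Lemma strip_list_edge n (a b : nat) : B <= b -> b < B + n -> (a == b - 2) || (a == b - 1) ->
  list_edge (E n) a b.
Proof.
move=> h1 h2 h3; rewrite /list_edge mem_family_edges h1 h2 h3 orbT andbT.
have := bounds; lia.
Qed.

(** Only a strip edge with label difference 2 that straddles the gap becomes too long; two strip
    edges through [p] or [p.+1] replace it. *)
Lemma stretch_edge n p (a b : nat) : B <= p -> p + 2 < B + n -> (a, b) \in E n ->
  list_edge (E n.+1) (stretch p a) (stretch p b) \/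
  exists2 z, (z == p) || (z == p.+1) &
    list_edge (E n.+1) (stretch p a) z && list_edge (E n.+1) z (stretch p b).
Proof.
move=> Bp pn abE; have bd := bounds.
have asc := allP (family_ascending spec n) _ abE; rewrite /ascending /= in asc.
have keep : (stretch p a, stretch p b) \in E n.+1 ->
    list_edge (E n.+1) (stretch p a) (stretch p b).
  by move=> h; rewrite /list_edge h andbT /stretch; do 2?case: ifP; lia.
move: abE; rewrite mem_family_edges => /or3P[h|h|h].
- left; apply: keep; rewrite mem_family_edges /stretch.
  have := allP (spec_edgesL spec) _ h; rewrite /= => h'.
  have [-> ->] : a <= p /\ b <= p by split; lia.
  by rewrite h.
- rewrite /stretch; case: (leqP b p) => bp.
    have -> : a <= p by lia.
    by left; apply: strip_list_edge; lia.
  case: (leqP a p) => ap; last by left; apply: strip_list_edge; lia.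
  case: (a =P b - 1) => ab1; first by left; apply: strip_list_edge; lia.
  (* If [a = p], then [b = p + 2] is stretched to [p + 3], reached through [p.+1]; otherwise
     [a = p - 1] and [b = p + 1] is stretched to [p + 2], reached through [p]. *)
  right; case: (a =P p) => aE.
    by exists p.+1; [rewrite eqxx orbT | apply/andP; split; apply: strip_list_edge; lia].
  by exists p; [rewrite eqxx | apply/andP; split; apply: strip_list_edge; lia].
- left; apply: keep; rewrite mem_family_edges; apply/or3P; apply: Or33.
  have h' := shifted_edgesR spec h.
  move/mapP: h => [[u v] uv [aE bE]].
  have := allP (spec_edgesR spec) _ uv; rewrite /= => h2.
  apply/mapP; exists (u, v) => //=; congr (_, _).
    by move: aE; rewrite /stretch /shift; do 2?case: ifP; lia.
  by move: bE; rewrite /stretch /shift; do 2?case: ifP; lia.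
Qed.

Lemma family_connected_step n : 8 <= n ->
  k_connected 3 (family c n) -> k_connected 3 (family c n.+1).
Proof.
move=> n8 /andP[_ /forallP cn]; have bd := bounds.
rewrite /k_connected card_ord; apply/andP; split; first by lia.
apply/forallP => S; apply/implyP => S3.
(* The pairs of consecutive vertices starting at [B], [B + 2] and [B + 4] are disjoint, so two
   vertices cannot hit all three. *)
have [p [Bp pB pS p1S]] : exists p, [/\ B <= p, p <= B + 4,
    (forall x, x \in S -> val x != p) & (forall x, x \in S -> val x != p.+1)].
  pose hit k := [exists x in S, (val x == B + k) || (val x == B + k.+1)].
  have free k : k <= 4 -> ~~ hit k -> exists p, [/\ B <= p, p <= B + 4,
    (forall x, x \in S -> val x != p) & (forall x, x \in S -> val x != p.+1)].
    move=> k4 /existsPn h; exists (B + k); split; [lia|lia| |] => x xS;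
    have := h x; rewrite xS /= negb_or => /andP[h1 h2] //.
    by rewrite -addnS.
  case: (boolP (hit 0)) => [|/free]; last by apply.
  case: (boolP (hit 2)) => [|/free h _]; last exact: h.
  case: (boolP (hit 4)) => [|/free h _ _]; last exact: h.
  move=> /existsP[x /andP[xS hx]] /existsP[y /andP[yS hy]] /existsP[z /andP[zS hz]].
  have : uniq [:: x; y; z].
    rewrite /= !inE negb_or !andbT; apply/andP; split; first (apply/andP; split).
    - by apply/eqP => xy; move: hx; rewrite xy => hx; move: hx hy; clear; lia.
    - by apply/eqP => xz; move: hx; rewrite xz => hx; move: hx hz; clear; lia.
    - by apply/eqP => yz; move: hy; rewrite yz => hy; move: hy hz; clear; lia.
  move=> ux; have := @uniq_leq_size _ [:: x; y; z] (enum S) ux; rewrite -cardE /= => h.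
  suff : 2 < #|S| by rewrite ltnNge -ltnS S3.
  by apply: h => t; rewrite !inE mem_enum => /or3P[]/eqP ->.
have Nn : 0 < B + n by lia.
have Nn1 : 0 < B + n.+1 by lia.
pose f (x : family c n.+1) : family c n := insubd (Ordinal Nn) (squeeze p (val x)).
pose g (y : family c n) : family c n.+1 := insubd (Ordinal Nn1) (stretch p (val y)).
have fE x : val (f x) = squeeze p (val x).
  rewrite val_insubd /squeeze; have := ltn_ord x.
  by case: ifP => //; case: ifP => //= ? ?; lia.
have gE y : val (g y) = stretch p (val y).
  rewrite val_insubd /stretch; have := ltn_ord y.
  by case: ifP => //; case: ifP => //= ? ?; lia.
have gS (y : family c n) : y \notin f @: S -> g y \notin S.
  apply: contra => gyS; apply/imsetP; exists (g y) => //; apply: val_inj.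
  by rewrite fE gE stretchK.
have nS (x : family c n.+1) : (val x == p) || (val x == p.+1) -> x \notin S.
  by move=> h; apply/negP => xS; have := pS x xS; have := p1S x xS; lia.
apply: (@connected_without_lift _ _ _ f g); last first.
- have /implyP := cn (f @: S); apply; apply: leq_ltn_trans S3.
  exact: leq_imset_card.
- move=> a b aS bS ab.
  wlog lt : a b aS bS ab / (val a, val b) \in E n => [h|].
    have /andP[_ /orP[ab'|ba]] := ab; first exact: h.
    rewrite avoiding_sym; apply: h => //.
    by move: ab; rewrite /= list_edge_sym.
  have gab := (gS a aS, gS b bS).
  have pn : p + 2 < B + n by lia.
  have [h|[z zp /andP[h1 h2]]] := @stretch_edge n p (val a) (val b) Bp pn lt.
    by apply: connect1; apply/and3P; split; rewrite ?gab // /= !gE.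
  have zN : z < B + n.+1 by lia.
  have zS := nS (Ordinal zN) zp.
  apply: (@connect_trans _ _ (Ordinal zN : family c n.+1)); apply: connect1;
  by apply/and3P; split; rewrite ?gab ?zS // /= !gE.
(* [p.+1] is sent back to its neighbour [p]; every other vertex returns to itself. *)
- move=> x xS; case: (val x =P p.+1) => [xp|/eqP xp].
    have vp : val (g (f x)) = p.
      by rewrite gE fE xp /squeeze ltnn /= /stretch leqnn.
    apply: connect1; apply/and3P; split=> //; last by apply: nS; rewrite vp eqxx.
    have ed : list_edge (E n.+1) (val (g (f x))) (val x).
      by rewrite vp xp; apply: strip_list_edge; lia.
    by rewrite /= list_edge_sym.
  have -> : g (f x) = x; last exact: connect0.
  by apply: val_inj; rewrite gE fE squeezeK.
(* [squeeze] identifies only [p] and [p.+1], and neither lies in [S]. *)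
- move=> x xS; apply/imsetP => -[y yS /(congr1 val)]; rewrite !fE => sE.
  have : val x != val y by apply: contraNneq xS => /val_inj ->.
  have := pS y yS; have := p1S y yS.
  move: sE; rewrite /squeeze; do 2?case: ifP; lia.
Qed.

Lemma family_three_connected n : three_connected_check (B + 8) (E 8) ->
  8 <= n -> k_connected 3 (family c n).
Proof.
move=> chk; elim: n => // n IH; rewrite leq_eqVlt => /predU1P[<-|n8].
  apply: three_connected_check_sound => //; last exact: family_ascending spec _.
  by have := bounds; lia.
by apply: family_connected_step => //; exact: IH.
Qed.

Lemma family_not_four_connected n k : 3 < k -> ~~ k_connected k (family c n).
Proof.
move=> k3; have bd := bounds; rewrite /k_connected negb_and; apply/orP; right.
apply/forallPn.
exists [set x : family c n | [|| val x == e, val x == B + n - 2 | val x == B + n - 1]]%SET.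
rewrite negb_imply; apply/andP; split.
  apply: leq_trans k3; rewrite ltnS.
  have eN : e < B + n by lia.
  have aN : B + n - 2 < B + n by lia.
  have bN : B + n - 1 < B + n by lia.
  apply: (@leq_trans #|[set Ordinal eN; Ordinal aN; Ordinal bN]|%SET).
    apply: subset_leq_card; apply/fintype.subsetP => x; rewrite !inE -!val_eqE /=.
    by rewrite orbA.
  by rewrite (leq_trans (leq_card_setU _ _)) // cards2 cards1; case: (_ != _).
set S := (X in ~~ connected_without X).
have oN : 0 < B + n by lia.
(* A vertex of the left cap other than [e], to be separated from vertex 0 of the right cap. *)
have [q qN qS] : exists2 q, q < B + n & [&& r <= q, q < B - 2 & q != e].
  by exists (if e == r then r.+1 else r); case: eqP => ?; lia.
apply/forallPn; exists (Ordinal oN); apply/forallPn; exists (Ordinal qN).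
rewrite negb_imply !inE /=; apply/andP; split; first by lia.
apply/negP => /connectP[s ps qE].
(* A walk from vertex 0 that avoids the three vertices never leaves the right cap. *)
have : val (last (Ordinal oN) s) < r.
  have : val (Ordinal oN) < r by rewrite /=; lia.
  elim: s (Ordinal oN) ps {qE} => //= y s IH x /andP[/and3P[xy xS yS] ps] xr.
  apply: IH ps _; move: xy yS; rewrite /list_edge => /andP[_ /orP[]];
  rewrite mem_family_edges => /or3P[/(allP (spec_edgesL spec))|h|/(shifted_edgesR spec)];
  rewrite ?inE /=; lia.
by rewrite -qE /=; lia.
Qed.

End FamilyConnectivity.

(** * The two pairs of caps *)

(** Edges list the smaller end first and vertices are swept in increasing order, so [u] can be
    retired at this vertex, which is [u] itself if it has no later neighbour. *)
Definition last_neighbour (es : seq (nat * nat)) (u : nat) :=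
  foldr maxn u [seq x.2 | x <- es & x.1 == u].

Definition retire (keep : seq nat) (es : seq (nat * nat)) (u v : nat) :=
  if (u \notin keep) && (last_neighbour es u == v) then [:: Drop u] else [::].

Definition sweep (keep vs : seq nat) (es : seq (nat * nat)) : seq (instr nat) :=
  flatten [seq Add v :: flatten [seq Edge x.1 v :: retire keep es x.1 v
                                | x <- es & x.2 == v] ++ retire keep es v v | v <- vs].

Definition make_caps (r B e : nat) (left_edges right_edges : seq (nat * nat)) :=
  Caps r B e (sweep [:: e; B - 2; B - 1] (iota r (B - r)) left_edges)
    ([seq Add v | v <- iota 0 r] ++ [seq Edge x.1 x.2 | x <- right_edges]).

Definition wheel_left : seq (nat * nat) :=
  [:: (5, 6); (5, 7); (6, 7); (5, 9); (5, 10); (6, 10); (6, 11); (7, 11);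
      (10, 11); (7, 12); (11, 12); (8, 13); (10, 13); (8, 14); (13, 14);
      (13, 15); (8, 16); (14, 16); (14, 17); (16, 17); (8, 18); (9, 18);
      (16, 18); (17, 18); (17, 19); (12, 20); (12, 21); (20, 21); (15, 22);
      (21, 22); (21, 23); (22, 23); (15, 24); (22, 24); (23, 24); (15, 25);
      (19, 25); (23, 25); (24, 25); (19, 26); (9, 27); (26, 27); (26, 28);
      (27, 28); (26, 29); (28, 29); (27, 30); (28, 30); (29, 30); (20, 31);
      (20, 32); (31, 32); (19, 33); (31, 33); (31, 34); (32, 34); (33, 34);
      (32, 35); (33, 35); (34, 35); (29, 36); (30, 36)].

(** The hub is 4 and the rim 0, 1, 2, 3. Of the spanning paths of the wheel that end at 2, the
    neighbour of [B-2], two start at 0 and three at 1, the neighbours of [B-1]: hence the factor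
    5. *)
Definition wheel_right : seq (nat * nat) :=
  [:: (0, 36); (1, 36); (2, 35); (3, 9); (0, 1); (1, 2); (0, 3); (2, 3);
      (0, 4); (1, 4); (2, 4); (3, 4)].

Definition wheel_caps : caps :=
  make_caps 5 37 9 wheel_left wheel_right.

Definition clique_left : seq (nat * nat) :=
  [:: (4, 5); (4, 6); (5, 6); (4, 7); (4, 8); (5, 8); (6, 8); (7, 8); (5, 9);
      (9, 10); (9, 11); (9, 12); (10, 12); (6, 13); (10, 14); (12, 14);
      (10, 15); (12, 15); (13, 15); (14, 15); (14, 16); (11, 17); (16, 17);
      (11, 18); (17, 18); (11, 19); (17, 19); (18, 19); (7, 20); (18, 20);
      (19, 20); (7, 21); (20, 21); (13, 22); (16, 23); (22, 23); (22, 24);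
      (23, 24); (22, 25); (23, 25); (24, 25); (21, 26); (21, 27); (26, 27);
      (13, 28); (26, 28); (27, 28); (26, 29); (27, 29); (28, 29); (24, 30);
      (25, 30)].

(** On the complete graph 0, 1, 2, 3, two spanning paths lead from 0 to 2 and two from 1 to 2: hence
    the factor 4. *)
Definition clique_right : seq (nat * nat) :=
  [:: (0, 30); (1, 30); (2, 29); (3, 16); (0, 1); (0, 2); (1, 2); (0, 3);
      (1, 3); (2, 3)].

Definition clique_caps : caps :=
  make_caps 4 31 16 clique_left clique_right.

Lemma wheel_spec : caps_spec wheel_caps 16250%num 5.
Proof. split; vm_compute; reflexivity. Qed.

Lemma clique_spec : caps_spec clique_caps 5120%num 4.
Proof. split; vm_compute; reflexivity. Qed.

Lemma wheel_check : three_connected_check (cap_B wheel_caps + 8)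
  (stream_edges (family_stream wheel_caps 8)).
Proof. vm_compute; reflexivity. Qed.

Lemma clique_check : three_connected_check (cap_B clique_caps + 8)
  (stream_edges (family_stream clique_caps 8)).
Proof. vm_compute; reflexivity. Qed.

Import Order.TTheory GRing.Theory Num.Theory.
Import numFieldNormedType.Exports.

(** * Straight-line drawings *)

Section Segments.
Variable R : realType.
Local Open Scope ring_scope.
Local Open Scope classical_set_scope.
Implicit Types p q a b c d : (R * R)%type.

Definition seg p q (t : R) : (R * R)%type :=
  (p.1 + t * (q.1 - p.1), p.2 + t * (q.2 - p.2)).

Lemma seg_continuous p q : continuous (seg p q).
Proof.
have lin (u v : R) : continuous (fun t : R => u + t * v).
  move=> t; apply: cvgD; first exact: cvg_cst.
  by apply: cvgM; [exact: cvg_id | exact: cvg_cst].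
move=> t; exact: (cvg_pair (lin p.1 (q.1 - p.1) t) (lin p.2 (q.2 - p.2) t)).
Qed.

Lemma seg0 p q : seg p q 0 = p.
Proof. by case: p => x y; rewrite /seg !mul0r !addr0. Qed.

Lemma seg1 p q : seg p q 1 = q.
Proof. by case: p q => x y [x' y']; rewrite /seg !mul1r /= ![_ + (_ - _)]addrC !subrK. Qed.

Lemma seg_inj p q s t : p <> q -> seg p q s = seg p q t -> s = t.
Proof.
case: p q => x y [x' y'] ne [/addrI h1 /addrI h2]; apply/eqP; apply: contra_notT ne => st.
have st0 : s - t != 0 by rewrite subr_eq0.
have e1 : (s - t) * (x' - x) = 0 by rewrite mulrBl; apply/eqP; rewrite subr_eq0 h1.
have e2 : (s - t) * (y' - y) = 0 by rewrite mulrBl; apply/eqP; rewrite subr_eq0 h2.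
move: e1 e2 => /eqP + /eqP; rewrite !mulf_eq0 (negPf st0) /= !subr_eq0.
by move=> /eqP -> /eqP ->.
Qed.

(** Twice the signed area of the triangle [a b c], an affine function of [c]. *)
Definition orient a b c : R :=
  (b.1 - a.1) * (c.2 - a.2) - (b.2 - a.2) * (c.1 - a.1).

Lemma orient_seg a b c d t :
  orient a b (seg c d t) = (1 - t) * orient a b c + t * orient a b d.
Proof.
have id (a1 a2 b1 b2 c1 c2 d1 d2 : R) :
    (b1 - a1) * (c2 + t * (d2 - c2) - a2) - (b2 - a2) * (c1 + t * (d1 - c1) - a1) =
    (1 - t) * ((b1 - a1) * (c2 - a2) - (b2 - a2) * (c1 - a1)) +
    t * ((b1 - a1) * (d2 - a2) - (b2 - a2) * (d1 - a1)) :> R by ring.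
exact: id.
Qed.

Lemma orient_on_seg a b s : orient a b (seg a b s) = 0.
Proof.
have id (a1 a2 b1 b2 : R) : (b1 - a1) * (a2 + s * (b2 - a2) - a2) -
    (b2 - a2) * (a1 + s * (b1 - a1) - a1) = 0 :> R by ring.
exact: id.
Qed.

Lemma convex_gt0 (t x y : R) : 0 < t < 1 -> 0 <= x -> 0 <= y -> 0 < x + y ->
  0 < (1 - t) * x + t * y.
Proof.
move=> /andP[t0 t1] x0 y0 xy; have t1' : 0 < 1 - t by lra.
have [x1|x1] := ltP 0 x.
  by apply: ltr_pwDl; [exact: mulr_gt0 | apply: mulr_ge0 => //; exact: ltW].
have -> : x = 0 by lra.
by rewrite mulr0 add0r mulr_gt0 //; lra.
Qed.

(** [orient a b] vanishes on the line through [a] and [b] and is positive inside the segment [c d].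
    One of [c], [d] may lie on the line, which admits edges with a common end. *)
Lemma seg_neq_side a b c d s t : 0 < t < 1 ->
  0 <= orient a b c -> 0 <= orient a b d ->
  0 < orient a b c + orient a b d -> seg a b s <> seg c d t.
Proof.
move=> t01 c0 d0 cd /(congr1 (orient a b)); rewrite orient_on_seg orient_seg => h.
by have := convex_gt0 t01 c0 d0 cd; rewrite -h ltxx.
Qed.

Lemma seg_neq_side_opp a b c d s t : 0 < t < 1 ->
  orient a b c <= 0 -> orient a b d <= 0 ->
  orient a b c + orient a b d < 0 -> seg a b s <> seg c d t.
Proof.
move=> t01 c0 d0 cd /(congr1 (orient a b)); rewrite orient_on_seg orient_seg => h.
have := @convex_gt0 t (- orient a b c) (- orient a b d) t01.
by rewrite !mulrN -!opprD -h oppr0 ltxx => /(_ _ _ _)/negP; apply; lra.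
Qed.

Definition of_N (x : N) : R := (N.to_nat x)%:R.
Definition point_of (x : N * N) : (R * R)%type := (of_N x.1, of_N x.2).

End Segments.

Section GridOrientation.
Local Open Scope N_scope.

(** The sign of [orient], with negative terms moved to the other side so that only natural numbers
    occur. *)
Definition grid_orient (a b c : N * N) : comparison :=
  N.compare (b.1 * c.2 + b.2 * a.1 + a.2 * c.1) (b.1 * a.2 + a.1 * c.2 + b.2 * c.1).

Definition grid_side (a b c d : N * N) : bool :=
  match grid_orient a b c, grid_orient a b d with
  | Gt, Lt | Lt, Gt | Eq, Eq => false
  | _, _ => true
  end.

End GridOrientation.

Section GridSegments.
Variable R : realType.
Local Open Scope ring_scope.

Lemma grid_orientP (a b c : N * N) :
  let o := orient (point_of R a) (point_of R b) (point_of R c) in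
  match grid_orient a b c with Gt => 0 < o | Eq => o = 0 | Lt => o < 0 end.
Proof.
move: a b c => [a1 a2] [b1 b2] [c1 c2]; rewrite /grid_orient /=.
set x := (_ + _)%num; set y := (_ + _)%num.
have -> : orient (point_of R (a1, a2)) (point_of R (b1, b2)) (point_of R (c1, c2)) =
          of_N R x - of_N R y.
  rewrite /orient /point_of /of_N /x /y /= !Nnat.N2Nat.inj_add !Nnat.N2Nat.inj_mul.
  by rewrite !plusE !multE !natrD !natrM; ring.
case: (N.compare_spec x y) => h.
- by rewrite h subrr.
- by rewrite subr_lt0 ltr_nat; lia.
- by rewrite subr_gt0 ltr_nat; lia.
Qed.

Lemma grid_side_neq (a b c d : N * N) (s t : R) : grid_side a b c d -> 0 < t < 1 ->
  seg (point_of R a) (point_of R b) s <> seg (point_of R c) (point_of R d) t.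
Proof.
rewrite /grid_side => h t01; have := grid_orientP a b c; have := grid_orientP a b d.
case: (grid_orient a b c) h; case: (grid_orient a b d) => //= _ h1 h2;
solve [apply: seg_neq_side => //; lra | apply: seg_neq_side_opp => //; lra].
Qed.

Lemma grid_orient_neq (a b c : N * N) (t : R) : grid_orient a b c <> Eq ->
  seg (point_of R a) (point_of R b) t <> point_of R c.
Proof.
move=> h /(congr1 (orient (point_of R a) (point_of R b))); rewrite orient_on_seg.
by have := grid_orientP a b c; case: (grid_orient a b c) h => // _ /=; lra.
Qed.

End GridSegments.

Section StraightLine.
Variable R : realType.
Local Open Scope ring_scope.
Local Open Scope classical_set_scope.

Lemma planar_list_graph (n : nat) (E : seq (nat * nat)) (pt : nat -> (R * R)%type) :
  all (ascending n) E ->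
  (forall i j, (i < n)%N -> (j < n)%N -> pt i = pt j -> i = j) ->
  (forall x z t, x \in E -> (z < n)%N -> 0 < t < 1 -> seg (pt x.1) (pt x.2) t <> pt z) ->
  (forall x y s t, x \in E -> y \in E -> x != y -> 0 < s < 1 -> 0 < t < 1 ->
     seg (pt x.1) (pt x.2) s <> seg (pt y.1) (pt y.2) t) ->
  planar R (list_graph n E).
Proof.
move=> asc inj avoid disj; set G := list_graph n E.
(* An edge, being a set, is turned back into a listed pair, which fixes the direction of its
   segment. *)
pose rep (F : {set G}) (x : G * G) :=
  ((val x.1, val x.2) \in E) && (F == [set x.1; x.2]%SET).
pose arc (F : {set G}) : R -> (R * R)%type :=
  if [pick x | rep F x] is Some x then seg (pt (val x.1)) (pt (val x.2))
  else fun=> (0, 0).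
have repP (F : {set G}) : F \in edges G ->
    exists2 x, rep F x & arc F = seg (pt (val x.1)) (pt (val x.2)).
  move=> FE; rewrite /arc; case: pickP => [x rx|no]; first by exists x.
  move: FE; rewrite inE => /existsP[u /existsP[v /andP[/andP[_ uv] /eqP FE]]].
  case/orP: uv => h.
    by have := no (u, v); rewrite /rep /= h FE eqxx.
  by have := no (v, u); rewrite /rep /= h FE finset.setUC eqxx.
have rep_lt (F : {set G}) x : rep F x -> (val x.1 < val x.2)%N.
  by move=> /andP[/(allP asc) /andP[]].
exists (fun v => pt (val v)), arc; split.
- by move=> u v /inj h; apply: val_inj; apply: h; exact: ltn_ord.
- move=> F /repP[x _ ->]; apply: continuous_subspaceT; exact: seg_continuous.
- move=> F /repP[x rx ->] s t _ _; apply: seg_inj => /inj h.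
  by have := rep_lt F x rx; rewrite h ?ltnn //; exact: ltn_ord.
- move=> u v uv F.
  have FE : F \in edges G.
    by rewrite inE; apply/existsP; exists u; apply/existsP; exists v; rewrite uv eqxx.
  have [[a b] rx ->] := repP F FE; rewrite seg0 seg1 /=.
  have /andP[_ /eqP /setP FE'] := rx; have ab := rep_lt F _ rx.
  have := FE' u; have := FE' v; rewrite !inE !eqxx ?orbT /= => /esym/orP h1 /esym/orP h2.
  have uNv : u != v by apply: contraTneq uv => ->; rewrite edge_irr.
  case: h1 h2 => /eqP h1 [] /eqP h2; subst; rewrite ?eqxx // in uNv *; by [left|right].
- move=> F /repP[x /andP[xE _] ->] t t01 z.
  by apply: (avoid (val x.1, val x.2)) => //; exact: ltn_ord.
- move=> F F' /repP[x rx ->] /repP[y ry ->] FF' s t s01 t01.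
  have /andP[xE /eqP Fx] := rx; have /andP[yE /eqP Fy] := ry.
  apply: (disj (val x.1, val x.2) (val y.1, val y.2)) => //.
  apply: contraNneq FF' => -[/val_inj e1 /val_inj e2].
  by rewrite Fx Fy e1 e2.
Qed.

End StraightLine.

(* Coordinates of a straight-line drawing of the two wheel caps without strip,
   indexed by vertex. *)
Definition wheel_table : seq (N * N) :=
  [:: (503, 0); (501, 125); (501, 250); (503, 500); (502, 200); (98, 446);
      (145, 420); (169, 407); (143, 410); (0, 500); (147, 416); (185, 398);
      (243, 369); (177, 392); (164, 396); (224, 364); (147, 405); (189, 376);
      (103, 434); (286, 310); (330, 325); (279, 347); (251, 354); (259, 348);
      (245, 352); (256, 340); (297, 239); (202, 309); (303, 213); (381, 134);
      (351, 157); (386, 297); (414, 287); (397, 282); (435, 275); (500, 250);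
      (500, 0)]%num.

Definition wheel_point (v : nat) : N * N := nth (0, 0)%num wheel_table v.

(** Two segments that fail both side tests cross or are collinear, so no other test for crossings is
    needed. *)
Definition grid_plane_check (vs : seq nat) (es : seq (nat * nat)) : bool :=
  all (fun x => all (fun y => (x == y) ||
        grid_side (wheel_point x.1) (wheel_point x.2) (wheel_point y.1) (wheel_point y.2) ||
        grid_side (wheel_point y.1) (wheel_point y.2) (wheel_point x.1) (wheel_point x.2))
      es &&
    all (fun z => [|| z == x.1, z == x.2 |
        if grid_orient (wheel_point x.1) (wheel_point x.2) (wheel_point z) is Eq
        then false else true]) vs) es.

(** The edge from 3 to 9 lengthens with the strip, whereas the other edges of the right cap are only
    translated. *)
Definition wheel_right_inner := [seq x <- wheel_right | x != (3, 9)].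

Lemma wheel_left_plane : grid_plane_check (iota 5 30) wheel_left.
Proof. vm_compute; reflexivity. Qed.

Lemma wheel_right_plane : grid_plane_check (iota 0 5) wheel_right_inner.
Proof. vm_compute; reflexivity. Qed.

Lemma wheel_point_left : all (fun v => N.ltb (wheel_point v).1 500 &&
  ((v == 9) || N.ltb (wheel_point v).2 500)) (iota 5 30).
Proof. vm_compute; reflexivity. Qed.

Lemma wheel_point_right : all (fun v => N.ltb 500 (wheel_point v).1 &&
  ((v == 3) || N.ltb (wheel_point v).2 500)) (iota 0 5).
Proof. vm_compute; reflexivity. Qed.

Lemma wheel_point_inj : uniq [seq wheel_point v | v <- iota 0 37].
Proof. vm_compute; reflexivity. Qed.

(** * The drawing of the wheel family *)

Lemma wheel_edges_left : stream_edges (cap_L wheel_caps) = wheel_left.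
Proof. by vm_compute. Qed.

Lemma wheel_edges_right : stream_edges (cap_R wheel_caps) = wheel_right.
Proof. by vm_compute. Qed.

Lemma wheel_left_bounds : all (fun x => [&& 5 <= x.1, x.1 < 35, x.1 < x.2 & x.2 < 37]) wheel_left.
Proof. by vm_compute. Qed.

Lemma wheel_right_bounds : all (fun x => [&& x.1 < 5, x.1 < x.2 &
  (x.2 < 5) || (x.2 == 35) || (x.2 == 36)]) wheel_right_inner.
Proof. by vm_compute. Qed.

Section WheelDrawing.
Variables (R : realType) (k : nat).
Local Open Scope ring_scope.

Local Notation E := (stream_edges (family_stream wheel_caps k.*2)).
Local Notation base v := (point_of R (wheel_point v)).

Definition translate (p : (R * R)%type) : (R * R)%type := (p.1 + k%:R, p.2).

(** Strip vertices form columns, [35 + 2j] at height 250 above [36 + 2j] at height 0. The even strip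
    length [k.*2] makes the last column the translate by [k] of the column 35, 36, to which the
    right cap is attached in the table. *)
Definition wheel_pt (v : nat) : (R * R)%type :=
  if (v < 5)%N then translate (base v) else if (v < 35)%N then base v
  else (500 + ((v - 35)./2)%:R, if odd v then 250 else 0).

Lemma seg_translate p q t : seg (translate p) (translate q) t = translate (seg p q t).
Proof.
have id (x y z : R) : x + z + t * (y + z - (x + z)) = x + t * (y - x) + z by ring.
by rewrite /seg /translate /= id.
Qed.

Lemma translate_inj : injective translate.
Proof. by move=> [x y] [x' y'] [/addIr -> ->]. Qed.

Lemma base_inj u v : (u < 37)%N -> (v < 37)%N -> base u = base v -> u = v.
Proof.
move=> u37 v37 [/eqP + /eqP]; rewrite !eqr_nat => /eqP/Nnat.N2Nat.inj h1 /eqP/Nnat.N2Nat.inj h2.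
apply: (uniq_map_inj wheel_point_inj); rewrite ?mem_iota //.
by rewrite [LHS]surjective_pairing [RHS]surjective_pairing h1 h2.
Qed.

Lemma base35 : base 35 = (500, 250).
Proof. by rewrite /point_of /of_N /=; congr (_, _); congr (_%:R); vm_compute. Qed.

Lemma base36 : base 36 = (500, 0).
Proof. by rewrite /point_of /of_N /=; congr (_, _); congr (_%:R); vm_compute. Qed.

Lemma wheel_pt_left v : (5 <= v < 37)%N -> wheel_pt v = base v.
Proof.
move=> v37; rewrite /wheel_pt; case: ifP; first by lia.
move=> _; case: ifP => // v35.
have [->|->] : v = 35 \/ v = 36 by lia.
  by rewrite base35 /= addr0.
by rewrite base36 /= addr0.
Qed.

Lemma wheel_pt_far v : (35 <= v)%N ->
  wheel_pt v = (500 + ((v - 35)./2)%:R, if odd v then 250 else 0).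
Proof.
move=> h; rewrite /wheel_pt.
have -> : (v < 5)%N = false by apply/negbTE; rewrite -leqNgt; exact: leq_trans h.
by rewrite ltnNge h.
Qed.

Lemma wheel_pt_right v : (v < 5)%N || (v == 35) || (v == 36) ->
  wheel_pt (shift 37 k.*2 v) = translate (base v).
Proof.
case: (ltnP v 5) => [v5 _|_ /=].
  have v35 : (v < 37 - 2)%N by exact: ltn_trans v5 _.
  by rewrite /shift v35 /wheel_pt v5.
move=> vE; have [h1 h2] : (35 <= v + k.*2)%N /\ ((v + k.*2 - 35)./2 = k)%N.
  by case/orP: vE => /eqP ->; split; lia.
have -> : shift 37 k.*2 v = (v + k.*2)%N.
  by rewrite /shift; case/orP: vE => /eqP ->.
rewrite wheel_pt_far // h2 oddD odd_double addbF.
by case/orP: vE => /eqP ->; rewrite ?base35 ?base36.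
Qed.

Lemma wheel_pt_top j : wheel_pt (35 + j.*2) = (500 + j%:R, 250).
Proof.
by rewrite wheel_pt_far ?leq_addr // addnC addnK doubleK oddD odd_double.
Qed.

Lemma wheel_pt_bottom j : wheel_pt (36 + j.*2) = (500 + j%:R, 0).
Proof.
rewrite wheel_pt_far; last by lia.
have -> : ((36 + j.*2 - 35)./2 = j)%N by lia.
by rewrite oddD odd_double.
Qed.

Lemma base_left v : (5 <= v < 35)%N ->
  (base v).1 < 500 /\ (if v == 9 then (base v).2 = 500 else (base v).2 < 500).
Proof.
move=> h; have := allP wheel_point_left v; rewrite mem_iota => /(_ h) /andP[/N.ltb_lt h1 h2].
split; first by rewrite /point_of /of_N /= ltr_nat; lia.
case: eqP h2 => [-> _|_ /N.ltb_lt h2]; last by rewrite /point_of /of_N /= ltr_nat; lia.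
by rewrite /point_of /of_N; congr (_%:R); vm_compute.
Qed.

Lemma base_right v : (v < 5)%N ->
  500 < (base v).1 /\ (if v == 3 then (base v).2 = 500 else (base v).2 < 500).
Proof.
move=> h; have := allP wheel_point_right v; rewrite mem_iota => /(_ h) /andP[/N.ltb_lt h1 h2].
split; first by rewrite /point_of /of_N /= ltr_nat; lia.
case: eqP h2 => [-> _|_ /N.ltb_lt h2]; last by rewrite /point_of /of_N /= ltr_nat; lia.
by rewrite /point_of /of_N; congr (_%:R); vm_compute.
Qed.

Variant strip_edge (x : nat * nat) (t : R) : Prop :=
| StripTop j of (j < k)%N & x = (35 + j.*2, 35 + j.+1.*2)%N &
    seg (wheel_pt x.1) (wheel_pt x.2) t = (500 + j%:R + t, 250)
| StripDiagonal j of (j < k)%N & x = (36 + j.*2, 35 + j.+1.*2)%N &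
    seg (wheel_pt x.1) (wheel_pt x.2) t = (500 + j%:R + t, 250 * t)
| StripBottom j of (j < k)%N & x = (36 + j.*2, 36 + j.+1.*2)%N &
    seg (wheel_pt x.1) (wheel_pt x.2) t = (500 + j%:R + t, 0)
| StripVertical j of (j < k)%N & x = (35 + j.+1.*2, 36 + j.+1.*2)%N &
    seg (wheel_pt x.1) (wheel_pt x.2) t = (500 + j%:R + 1, 250 - 250 * t).

Lemma strip_edgeP (a b : nat) t : (37 <= b)%N -> (b < 37 + k.*2)%N ->
  (a == b - 2)%N || (a == b - 1)%N -> strip_edge (a, b) t.
Proof.
move=> b37 bk ab; pose j := ((b - 37)./2)%N.
have jk : (j < k)%N by rewrite /j; lia.
have sj : (j.+1%:R = j%:R + 1 :> R) by rewrite -addn1 natrD.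
have mk (x y x' y' : R) : seg (x, y) (x', y') t = (x + t * (x' - x), y + t * (y' - y)) by [].
have [bE|bE] : (b = 35 + j.+1.*2 \/ b = 36 + j.+1.*2)%N by rewrite /j; lia.
- have [aE|aE] : (a = 35 + j.*2 \/ a = 36 + j.*2)%N by rewrite /j; lia.
  + apply: (StripTop jk); first by rewrite aE bE.
    rewrite /= aE bE !wheel_pt_top mk sj; congr (_, _); ring.
  + apply: (StripDiagonal jk); first by rewrite aE bE.
    rewrite /= aE bE wheel_pt_top wheel_pt_bottom mk sj; congr (_, _); ring.
- have [aE|aE] : (a = 36 + j.*2 \/ a = 35 + j.+1.*2)%N by rewrite /j; lia.
  + apply: (StripBottom jk); first by rewrite aE bE.
    rewrite /= aE bE !wheel_pt_bottom mk sj; congr (_, _); ring.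
  + apply: (StripVertical jk); first by rewrite aE bE.
    rewrite /= aE bE wheel_pt_top wheel_pt_bottom mk sj; congr (_, _); ring.
Qed.

(** Points of different regions differ in a coordinate: vertical lines at 500 and [500 + k] separate
    the caps from the strip, and only the long edge runs at height 500. Crossings remain to be
    excluded within one region. *)
Variant edge_region (x : nat * nat) (t : R) (P : (R * R)%type) : Prop :=
| InLeft of x \in wheel_left & P.1 < 500 & P.2 < 500 &
    P = seg (base x.1) (base x.2) t
| InStrip of strip_edge x t & 500 <= P.1 & P.1 <= 500 + k%:R & P.2 <= 250
| InRight y of y \in wheel_right_inner & x = (shift 37 k.*2 y.1, shift 37 k.*2 y.2) &
    500 + k%:R < P.1 & P.2 < 500 & P = translate (seg (base y.1) (base y.2) t)
| OnTop of x = (3, 9)%N & P.2 = 500.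

Lemma edge_regionP x t : x \in E -> 0 < t < 1 ->
  edge_region x t (seg (wheel_pt x.1) (wheel_pt x.2) t).
Proof.
have segE1 p q : (seg p q t).1 = (1 - t) * p.1 + t * q.1 :> R by rewrite /seg /=; ring.
have segE2 p q : (seg p q t).2 = (1 - t) * p.2 + t * q.2 :> R by rewrite /seg /=; ring.
move=> xE t01; case: x xE => a b.
(* One end may attain the bound, such as vertex 9 at height 500 or vertices 35 and 36 at abscissa
   500. *)
have comb (x y m : R) : x <= m -> y <= m -> x + y < m + m -> (1 - t) * x + t * y < m.
  move=> hx hy hxy; have := @convex_gt0 R t (m - x) (m - y) t01; lra.
rewrite (mem_family_edges wheel_spec) wheel_edges_left wheel_edges_right.
have le500 v : (5 <= v < 37)%N -> (base v).1 <= 500 /\ (base v).2 <= 500.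
  case: (ltnP v 35) => h1 h2.
    have [|e1 e2] := @base_left v; first by lia.
    by split; [exact: ltW | case: eqP e2 => _ e2; [rewrite e2 | exact: ltW]].
  have [->|->] : v = 35 \/ v = 36 by lia.
    by rewrite base35 /=; split; lra.
  by rewrite base36 /=; split; lra.
have lt500 v : (5 <= v < 37)%N -> v != 9 -> (base v).2 < 500.
  case: (ltnP v 35) => h1 h2 v9.
    have [|_] := @base_left v; first by lia.
    by rewrite (negPf v9).
  have [->|->] : v = 35 \/ v = 36 by lia.
    by rewrite base35 /=; lra.
  by rewrite base36 /=; lra.
case/or3P => [h|/and3P[h1 h2 h3]|/mapP[[u v] h /= xE]].
- have /= bd := allP wheel_left_bounds _ h.
  have ha : (5 <= a < 35)%N by move: bd; clear; lia.
  have ha' : (5 <= a < 37)%N by move: bd; clear; lia.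
  have hb : (5 <= b < 37)%N by move: bd; clear; lia.
  have [a1 _] := base_left ha.
  have [_ a2] := le500 a ha'; have [b1 b2] := le500 b hb.
  rewrite /= (wheel_pt_left ha') (wheel_pt_left hb); apply: InLeft => //.
    by rewrite segE1; apply: comb => //; [exact: ltW | move: a1 b1; clear; lra].
  rewrite segE2; apply: comb => //.
  case: (a =P 9) => [a9|/eqP a9].
    have b9 : b != 9 by move: bd; rewrite a9; clear; lia.
    by move: (lt500 b hb b9) a2; clear; lra.
  by move: (lt500 a ha' a9) b2; clear; lra.
- have S := @strip_edgeP a b t h1 h2 h3.
  have jR (j : nat) : (j < k)%N -> 0 <= j%:R :> R /\ j%:R + 1 <= k%:R :> R.
    by move=> jk; rewrite natr1 ler_nat.
  by apply: InStrip => //; case: S => j /jR[j0 j1] _ -> /=; move: j0 j1 t01; clear; lra.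
- case: (boolP ((u, v) == (3, 9)%N)) => [/eqP[uE vE]|uv].
    apply: OnTop; first by rewrite xE uE vE.
    case: xE => -> ->; rewrite uE vE wheel_pt_right // [wheel_pt _]wheel_pt_left //.
    have [_ e1] := @base_right 3 isT; have [_ e2] := @base_left 9 isT.
    rewrite segE2 (_ : (translate (base 3)).2 = (base 3).2) // (_ : shift 37 k.*2 9 = 9) // e1 e2; ring.
  have yin : (u, v) \in wheel_right_inner by rewrite mem_filter uv.
  have /= bd := allP wheel_right_bounds _ yin.
  have xE' := xE; case: xE' => -> ->.
  have hu : (u < 5)%N || (u == 35) || (u == 36) by move: bd; clear; lia.
  have hv : (v < 5)%N || (v == 35) || (v == 36) by move: bd; clear; lia.
  rewrite /= (wheel_pt_right hu) (wheel_pt_right hv) seg_translate.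
  have ge500 w : (w < 5)%N || (w == 35) || (w == 36) -> 500 <= (base w).1 /\ (base w).2 <= 500.
    case: (ltnP w 5) => w5.
      by have [] := base_right w5; case: eqP; lra.
    move=> /orP[]/eqP ->; first by rewrite base35 /=; split; lra.
    by rewrite base36 /=; split; lra.
  have u5 : (u < 5)%N by move: bd; clear; lia.
  have [u1 u2] := base_right u5.
  have [_ u2'] := ge500 u hu; have [v1 v2] := ge500 v hv.
  have lt2 : (base u).2 + (base v).2 < 500 + 500.
    case: eqP u2 => [u3 _|_ u2]; last by move: u2 v2; clear; lra.
    suff : (base v).2 < 500 by move: u2'; clear; lra.
    case: (ltnP v 5) => v5.
      have [_] := base_right v5; case: eqP => // v3.
      by move: bd; rewrite u3 v3.
    have [->|->] : (v = 35 \/ v = 36)%N by move: bd v5; clear; lia.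
      by rewrite base35 /=; clear; lra.
    by rewrite base36 /=; clear; lra.
  apply: (InRight yin) => //.
  + have -> : (translate (seg (base u) (base v) t)).1 = (seg (base u) (base v) t).1 + k%:R by [].
    have := @convex_gt0 R t ((base u).1 - 500) ((base v).1 - 500) t01.
    rewrite segE1 => c; have {}c : 0 < (1 - t) * ((base u).1 - 500) + t * ((base v).1 - 500).
      by apply: c; move: u1 v1; clear; lra.
    by move: c; clear; lra.
  + have -> : (translate (seg (base u) (base v) t)).2 = (seg (base u) (base v) t).2 by [].
    by rewrite segE2; exact: comb.
Qed.

Lemma wheel_pt_zone z : (z < 37 + k.*2)%N ->
  [\/ (z < 5)%N /\ 500 + k%:R < (wheel_pt z).1,
      (5 <= z < 35)%N /\ (wheel_pt z).1 < 500 |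
      (35 <= z)%N /\ exists i y, [/\ (i <= k)%N, wheel_pt z = (500 + i%:R, y) &
                                  y = 250 \/ y = 0]].
Proof.
move=> zN; rewrite /wheel_pt; case: (ltnP z 5) => z5.
  apply: Or31; split=> //; have [h _] := base_right z5.
  have -> : (translate (base z)).1 = (base z).1 + k%:R by [].
  by move: h; clear; lra.
case: (ltnP z 35) => z35.
  by apply: Or32; split; [lia | have [] := @base_left z; lia].
apply: Or33; split=> //; exists ((z - 35)./2)%N, (if odd z then 250 else 0).
by split=> //; [lia | case: odd; [left | right]].
Qed.

Lemma wheel_pt_inj i j : (i < 37 + k.*2)%N -> (j < 37 + k.*2)%N ->
  wheel_pt i = wheel_pt j -> i = j.
Proof.
have k0 : 0 <= k%:R :> R by [].
move=> iN jN ij.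
have zi := wheel_pt_zone iN; have zj := wheel_pt_zone jN; rewrite -ij in zj.
have ik (l : nat) : (l <= k)%N -> 0 <= l%:R :> R /\ l%:R <= k%:R :> R.
  by move=> h; rewrite ler_nat.
have off (l : nat) y (Q : Prop) : (l <= k)%N -> wheel_pt i = (500 + l%:R, y) ->
    500 + k%:R < (wheel_pt i).1 \/ (wheel_pt i).1 < 500 -> Q.
  move=> /ik[l0 l1] ->; rewrite /= => h; exfalso; case: h; move: l0 l1; clear; lra.
case: zi zj => -[hi h] [] [hj h'].
- move: ij; rewrite /wheel_pt hi hj => /translate_inj; apply: base_inj; lia.
- by exfalso; move: h h' k0; clear; lra.
- by case: h' => l [y [lk e _]]; apply: off lk e _; left.
- by exfalso; move: h h' k0; clear; lra.
- move: ij; rewrite !wheel_pt_left; try lia; apply: base_inj; lia.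
- by case: h' => l [y [lk e _]]; apply: off lk e _; right.
- by case: h => l [y [lk e _]]; apply: off lk e _; left.
- by case: h => l [y [lk e _]]; apply: off lk e _; right.
move: ij; rewrite !wheel_pt_far // => -[/addrI/eqP]; rewrite eqr_nat => /eqP h2 h1.
have : odd i = odd j.
  by case: (odd i) h1; case: (odd j) => // h1; exfalso; move: h1; clear; lra.
lia.
Qed.

Lemma wheel_avoids x z t : x \in E -> (z < 37 + k.*2)%N -> 0 < t < 1 ->
  seg (wheel_pt x.1) (wheel_pt x.2) t <> wheel_pt z.
Proof.
move=> xE zN t01 eqz.
have asc : (x.1 < x.2)%N && (x.2 < 37 + k.*2)%N.
  exact: (allP (family_ascending wheel_spec k.*2) _ xE).
have k0 : 0 <= k%:R :> R by [].
have ne : wheel_pt x.1 <> wheel_pt x.2.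
  have /andP[x12 x2] := asc.
  move=> /(wheel_pt_inj (ltn_trans x12 x2) x2) h.
  by move: x12; rewrite h ltnn.
have z1 : z != x.1.
  apply/eqP => zE; move: eqz; rewrite zE -{2}(seg0 (wheel_pt x.1) (wheel_pt x.2)).
  by move=> /(seg_inj ne) t0; move: t01; rewrite t0 ltxx.
have z2 : z != x.2.
  apply/eqP => zE; move: eqz; rewrite zE -{2}(seg1 (wheel_pt x.1) (wheel_pt x.2)).
  by move=> /(seg_inj ne) t1; move: t01; rewrite t1 ltxx andbF.
have off (l : nat) y : (l <= k)%N -> wheel_pt z = (500 + l%:R, y) ->
    500 + k%:R < (wheel_pt z).1 \/ (wheel_pt z).1 < 500 -> False.
  move=> lk ->; have l0 : 0 <= l%:R :> R by [].
  have l1 : l%:R <= k%:R :> R by rewrite ler_nat.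
  by rewrite /= => -[]; move: l0 l1; clear; lra.
have zz := wheel_pt_zone zN.
case: (edge_regionP xE t01) => [xl p1 p2 pE|S p1 p1' p2|y yin xy p1 p2 pE|xE' p2].
- rewrite eqz in p1 p2; case: zz => -[hz h]; first by move: p1 h k0; clear; lra.
    have /andP[_ /allP/(_ z)] := allP wheel_left_plane _ xl.
    rewrite mem_iota => /(_ hz); rewrite (negPf z1) (negPf z2) /= => ho.
    rewrite pE wheel_pt_left in eqz; last by lia.
    by apply: grid_orient_neq eqz => e; rewrite e in ho.
  by case: h => l [y [lk e _]]; apply: off lk e _; right.
- rewrite eqz in p1 p1' p2; case: zz => -[hz h].
  + by move: p1' h; clear; lra.
  + by move: p1 h; clear; lra.
  case: h => i [y [ik' e yv]]; rewrite e in eqz.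
  (* A point inside a strip edge lies strictly between two columns or, on a vertical edge, strictly
     between the heights 0 and 250. *)
  have dich (j : nat) : i%:R <= j%:R :> R \/ j%:R + 1 <= i%:R :> R.
    by case: (leqP i j) => h; [left | right]; rewrite ?natr1 ler_nat.
  case: S eqz => j jk _ -> [e1 e2]; have := dich j; case: yv e2 => -> e2 [];
  by move: e1 e2 t01; clear; lra.
- rewrite eqz in p1 p2; case: zz => -[hz h]; last first.
  + by case: h => l [y' [lk e _]]; apply: off lk e _; left.
  + by move: p1 h k0; clear; lra.
  have /andP[_ /allP/(_ z)] := allP wheel_right_plane _ yin.
  rewrite mem_iota => /(_ hz).
  have sz : z = shift 37 k.*2 z.
    by rewrite /shift (_ : (z < 37 - 2)%N); last exact: ltn_trans hz _.
  have y1 : z != y.1 by apply: contraNneq z1 => zy; rewrite xy /= -zy -sz.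
  have y2 : z != y.2 by apply: contraNneq z2 => zy; rewrite xy /= -zy -sz.
  rewrite (negPf y1) (negPf y2) /= => ho.
  rewrite pE /wheel_pt hz in eqz.
  by apply: grid_orient_neq (translate_inj eqz) => e; rewrite e in ho.
- rewrite eqz in p2; rewrite xE' /= in z1 z2; case: zz => -[hz h].
  + have [_] := base_right hz; rewrite (negPf z1) => hb.
    have e2 : (wheel_pt z).2 = (base z).2 by rewrite /wheel_pt hz.
    by move: p2 hb e2; clear; lra.
  + have [_] := base_left hz; rewrite (negPf z2) => hb.
    have e2 : (wheel_pt z).2 = (base z).2 by rewrite wheel_pt_left //; lia.
    by move: p2 hb e2; clear; lra.
  + by case: h => l [y [_ e yv]]; move: p2; rewrite e /=; case: yv => ->; clear; lra.
Qed.

Lemma strip_disjoint x y s t (P : (R * R)%type) : strip_edge x s -> strip_edge y t ->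
  P = seg (wheel_pt x.1) (wheel_pt x.2) s -> P = seg (wheel_pt y.1) (wheel_pt y.2) t ->
  x != y -> 0 < s < 1 -> 0 < t < 1 -> False.
Proof.
move=> S S' -> + + s01 t01.
(* Inside an edge of index [j] the abscissa exceeds [500 + j] and is at most [500 + j + 1], so edges
   of different index never meet. *)
have tri (i j : nat) : i%:R + 1 <= j%:R :> R \/ j%:R + 1 <= i%:R :> R \/ i = j.
  by case: (ltngtP i j) => h; [left|right; left|right; right] => //; rewrite natr1 ler_nat.
case: S => j _ -> -> {x}; case: S' => j' _ -> -> {y} eqP xy;
have e1 := congr1 fst eqP; have e2 := congr1 snd eqP; rewrite /= in e1 e2;
(have [h|[h|h]] := tri j j';
[ by move: e1 e2 s01 t01 h; clear; lra
| by move: e1 e2 s01 t01 h; clear; lra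
| subst j'; first [ by move: xy; rewrite eqxx
                  | by move: e1 e2 s01 t01; clear; lra ] ]).
Qed.

Lemma wheel_disjoint x y s t : x \in E -> y \in E -> x != y -> 0 < s < 1 -> 0 < t < 1 ->
  seg (wheel_pt x.1) (wheel_pt x.2) s <> seg (wheel_pt y.1) (wheel_pt y.2) t.
Proof.
have k0 : 0 <= k%:R :> R by [].
move=> xE yE xy s01 t01 xyE.
have [P PE1 PE2] : exists2 P, P = seg (wheel_pt x.1) (wheel_pt x.2) s &
    P = seg (wheel_pt y.1) (wheel_pt y.2) t.
  by exists (seg (wheel_pt x.1) (wheel_pt x.2) s).
have rx := edge_regionP xE s01; have ry := edge_regionP yE t01.
rewrite -PE1 in rx; rewrite -PE2 in ry.
case: rx => [xl p1 p2 pE|S p1 p1' p2|u uin xu p1 p2 pE|xE' p2];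
case: ry => [yl q1 q2 qE|S' q1 q1' q2|v vin yv q1 q2 qE|yE' q2];
try solve [ by move: k0 p1 q1; clear; lra | by move: p2 q2; clear; lra
          | by move: p1' q1; clear; lra | by move: p1 q1'; clear; lra ].
- have /andP[/allP/(_ y yl)] := allP wheel_left_plane _ xl.
  rewrite (negPf xy) /= => /orP[] side _; rewrite pE in qE.
    exact: grid_side_neq side t01 qE.
  exact: grid_side_neq side s01 (esym qE).
- exact: (strip_disjoint S S' PE1 PE2).
- have /andP[/allP/(_ v vin)] := allP wheel_right_plane _ uin.
  have uv : u != v by apply: contraNneq xy => uv; rewrite xu yv uv.
  rewrite (negPf uv) /= => /orP[] side _; rewrite pE in qE; have {}qE := translate_inj qE.
    exact: grid_side_neq side t01 qE.
  exact: grid_side_neq side s01 (esym qE).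
- by move: xy; rewrite xE' yE' eqxx.
Qed.

Theorem wheel_family_planar : planar R (family wheel_caps k.*2).
Proof.
apply: (@planar_list_graph R _ _ wheel_pt).
- exact: (family_ascending wheel_spec).
- exact: wheel_pt_inj.
- exact: wheel_avoids.
- exact: wheel_disjoint.
Qed.

End WheelDrawing.

(** * Conclusion for both families *)

Lemma connectivity_eq3 (G : sgraph) : 3 < #|G| -> k_connected 3 G ->
  (forall k, 3 < k -> ~~ k_connected k G) -> connectivity G = 3.
Proof.
move=> G3 c3 n4; apply/eqP; rewrite eqn_leq; apply/andP; split.
  apply/bigmax_leqP => k ck; rewrite leqNgt; apply/negP => /n4.
  by rewrite ck.
exact: (@leq_bigmax_cond _ (fun k : 'I_#|G| => k_connected k G) val (Ordinal G3)).
Qed.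

Theorem theorem2 (R : realType) :
  infinitely_many (fun G : sgraph =>
    regular 4 G /\ connectivity G = 3 /\
    #|hamiltonian_cycles G| = 2 ^ 12 * 5)
  /\
  infinitely_many (fun G : sgraph =>
    regular 4 G /\ polyhedral R G /\
    #|hamiltonian_cycles G| = 2 * 5 ^ 5 * 13).
Proof.
split.
(* Lengths start at 8, where 3-connectivity was evaluated. *)
- exists (fun i => family clique_caps (8 + i)); split=> [i j ij|i].
    by apply: family_not_iso => /addnI.
  split; first exact: (family_regular clique_spec).
  split; last by rewrite (family_hamiltonian clique_spec) (_ : N.to_nat 5120%num = 2 ^ 10 * 5);
    [lia | vm_compute].
  apply: connectivity_eq3.
  + by rewrite card_ord.
  + exact: (family_three_connected clique_spec clique_check).
  + exact: (family_not_four_connected clique_spec).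
(* Again from 8 on, but even, since the drawing advances by whole columns. *)
- exists (fun i => family wheel_caps (4 + i).*2); split=> [i j ij|i].
    by apply: family_not_iso => /double_inj/addnI.
  split; first by apply: (family_regular wheel_spec); lia.
  split; last by rewrite (family_hamiltonian wheel_spec) (_ : N.to_nat 16250%num = 2 * 5 ^ 4 * 13);
    [lia | vm_compute].
  split; first exact: wheel_family_planar.
  by apply: (family_three_connected wheel_spec wheel_check); lia.
Qed.
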